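(* Assume (A3), (A4). Suppose either $p\in(0,2)$, $q\in(0,1]$ and $q+1<p$, or $p=2$, $q\in(0,1)$ and $\beta\ge q(1-q)$. Let $x$ be a bounded trajectory solution of (MTRIGS) with initial data $(x_0,v_0)$. Then for each $i$ the limit $f_i^\infty:=\lim_{t\to\infty}f_i(x(t))\in\mathbb R$ exists, and $x(t)$ converges weakly, as $t\to+\infty$, to a weak Pareto optimal point of $\min_{x\in\mathcal H}F(x)$ which belongs to $\bigcap_{i=1}^m\{x\in\mathcal H: f_i(x)\le f_i^\infty\}$.
   Context: $\mathcal H$ real Hilbert space; $f_1,\dots,f_m:\mathcal H\to\mathbb R$ convex, continuously differentiable with Lipschitz continuous gradients; $F=(f_1,\dots,f_m)^\top$. Weak Pareto optimal: no $x$ with $f_i(x)<f_i(x^* )$ for all $i$; $\mathcal P_w$ the set of such points. $\mathcal L(F,b):=\{x:f_i(x)\le b_i\ \forall i\}$, $\mathcal{LP}_w(F,b):=\mathcal L(F,b)\cap\mathcal P_w$. Parameters $t_0>0$, $\alpha,\beta>0$, $q\in(0,1]$, $p\in(0,2]$, initial data $x_0,v_0\in\mathcal H$; $C(x):=\operatorname{conv}\{\nabla f_i(x)\}$. A trajectory solution of (MTRIGS) is $x:[t_0,\infty)\to\mathcal H$, continuously differentiable, with $\dot x$ absolutely continuous on each $[t_0,T]$ and a.e. derivative $\ddot x$ (Bochner measurable, $\dot x(t)=\dot x(t_0)+\int_{t_0}^t\ddot x$), satisfying $\frac{\alpha}{t^q}\dot x(t)+\operatorname{proj}_{C(x(t))+\frac{\beta}{t^p}x(t)+\ddot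 x(t)}(0)=0$ for a.e. $t\ge t_0$, $x(t_0)=x_0$, $\dot x(t_0)=v_0$. (A3): with $a_i:=\frac{\beta}{2t_0^p}\|x_0\|^2+\frac12\|v_0\|^2$, for every $x\in\mathcal L(F,F(x_0)+a)$, $\mathcal{LP}_w(F,F(x))\ne\emptyset$, and $R:=\sup_{F^*\in F(\mathcal{LP}_w(F,F(x_0)+a))}\inf_{z\in F^{-1}(\{F^*\})}\|z\|<\infty$. (A4): $S(w):=\operatorname{argmin}_z\max_i(f_i(z)-w_i)\neq\emptyset$ for all $w\in\mathbb R^m$ and $w\mapsto\operatorname{proj}_{S(w)}(0)$ is continuous. *)

(* Defs.v *)
From HB Require Import structures.
From mathcomp Require Import all_boot all_order all_algebra.
From mathcomp Require Import all_classical all_reals all_analysis.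
Set Implicit Arguments. Unset Strict Implicit. Unset Printing Implicit Defensive.
Import Order.TTheory GRing.Theory Num.Theory.
Import numFieldNormedType.Exports.
Local Open Scope ring_scope.
Local Open Scope classical_set_scope.

Section Defs.
Context {R : realType} {V : normedModType R}.

(* inner product inducing the norm of V: with V complete, (V, inner) is a real Hilbert space *)
Definition is_inner (inner : V -> V -> R) : Prop :=
  [/\ forall x y, inner x y = inner y x,
      forall x y z, inner (x + y) z = inner x z + inner y z,
      forall (a : R) x y, inner (a *: x) y = a * inner x y
    & forall x, inner x x = `|x| ^+ 2].

Definition is_gradient (inner : V -> V -> R) (f : V -> R) (g : V -> V) : Prop :=
  forall x (e : R), 0 < e -> exists2 d : R, 0 < d &
    forall h : V, `|h| < d -> `|f (x + h) - f x - inner (g x) h| <= e * `|h|.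

Definition convex_fun (f : V -> R) : Prop :=
  forall x y (l : R), 0 <= l <= 1 ->
    f (l *: x + (1 - l) *: y) <= l * f x + (1 - l) * f y.

Definition lipschitz_map (g : V -> V) : Prop :=
  exists L : R, forall x y, `|g x - g y| <= L * `|x - y|.

Definition is_proj (K : set V) (y z : V) : Prop :=
  K z /\ forall w, K w -> `|y - z| <= `|y - w|.

Definition abs_cont_on (v : R -> V) (a b : R) : Prop :=
  forall e : R, 0 < e -> exists2 d : R, 0 < d &
    forall (n : nat) (u w : nat -> R),
      (forall k, (k < n)%N -> a <= u k <= w k /\ w k <= b) ->
      (forall k, (k.+1 < n)%N -> w k <= u k.+1) ->
      \sum_(k < n) (w k - u k) < d ->
      \sum_(k < n) `|v (w k) - v (u k)| < e.

Variable m : nat.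
Variable f : 'I_m -> V -> R.

Definition weak_pareto (xs : V) : Prop :=
  ~ (exists z, forall i, f i z < f i xs).

Definition levelset (b : 'I_m -> R) : set V := [set z | forall i, f i z <= b i].

Definition LPw (b : 'I_m -> R) : set V := levelset b `&` [set z | weak_pareto z].

Definition convhull (g : 'I_m -> V -> V) (x : V) : set V :=
  [set y | exists lam : 'I_m -> R, (forall i, 0 <= lam i) /\ \sum_i lam i = 1
           /\ y = \sum_i lam i *: g i x].

(* S(w) = argmin_z max_i (f_i z - w_i) *)
Definition argmin_max (w : 'I_m -> R) : set V :=
  [set z | forall y, exists j, forall i, f i z - w i <= f j y - w j].

End Defs.

(* Main.v *)
Require Import Defs.
From HB Require Import structures.
From mathcomp Require Import all_boot all_order all_algebra.
From mathcomp Require Import all_classical all_reals all_analysis.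
From mathcomp Require Import ring lra.
Set Implicit Arguments. Unset Strict Implicit. Unset Printing Implicit Defensive.
Import Order.TTheory GRing.Theory Num.Theory.
Import numFieldNormedType.Exports.
Local Open Scope ring_scope.
Local Open Scope classical_set_scope.

(* Each energy W_i = f_i(x) + beta / (2 t^p) |x|^2 + |x'|^2 / 2 satisfies W_i' <= - alpha / t^q |x'|^2, hence
   decreases to some f_i^oo, and W_i - f_i^oo dominates k(t), the integral of alpha / s^q |x'|^2 over [t, +oo).
   If f_i(z) <= f_i^oo for all i, then h = |x - z|^2 / 2 satisfies
     h'' + alpha / t^q h' <= 3/2 |x'|^2 - k + beta / 2 |z|^2 / t^p.
   As q < 1 and q + 1 < p, multiplying by t^q and adding a multiple of t^(2q) k yields a Lyapunov function which
   shows that t^q |x'|^2 is integrable and that h converges. A weak cluster point of x satisfies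
   f_i <= f_i^oo by the gradient inequality, so Opial's lemma gives weak convergence to some x^oo. Since
   |x'|^2 is integrable with derivative bounded above, x' tends to 0 and f_i(x(t)) tends to f_i^oo. Finally,
   if z had f_i(z) < f_i(x^oo) for all i, then h'' would be eventually below a negative constant, which
   is incompatible with the boundedness of h'. *)

(** The acceleration exists only almost everywhere, so a monotone quantity containing x' is out of
    reach of the mean value theorem; each such step uses an almost-everywhere criterion for
    functions whose increments are controlled by those of x'. The projection hides a multiplier c(t)
    in the convex hull of the gradients, about whose dependence on t nothing is known. It is
    eliminated pointwise by two inequalities: against x', where it makes all energies dissipate at
    once, and against x - z, where convexity applies. The tail k makes the second-order inequality
    usable: since k' = - alpha t^(-q) |x'|^2, the derivative of t^(2q) k contains - alpha t^q
    |x'|^2, which absorbs the harmful term 3/2 t^q |x'|^2. The condition q + 1 < p is the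
    integrability of t^(q-p), the weighted contribution of the Tikhonov term. Weak cluster points
    are taken along ultrafilters, which suits continuous time and avoids extracting subsequences. *)

Lemma is_derive_cvg {R : realType} {V : normedModType R} (v : R -> V) (dv : V) (t : R) :
  is_derive (t : R^o) (1 : R^o) v dv -> v @ t --> v t.
Proof.
move=> [dv1 _].
by have /derivable1_diffP/differentiable_continuous := dv1.
Qed.

(** * Inner products that induce the norm *)

Section InnerProduct.
Context {R : realType} {V : normedModType R} {inner : V -> V -> R}.
Hypothesis Hin : is_inner inner.
Local Notation "⟨ u , v ⟩" := (inner u v).

Lemma innerC u v : ⟨u, v⟩ = ⟨v, u⟩.
Proof. by case: Hin. Qed.

Lemma innerDl u v w : ⟨u + v, w⟩ = ⟨u, w⟩ + ⟨v, w⟩.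
Proof. by case: Hin. Qed.

Lemma innerZl (a : R) u v : ⟨a *: u, v⟩ = a * ⟨u, v⟩.
Proof. by case: Hin. Qed.

Lemma inner_norm u : ⟨u, u⟩ = `|u| ^+ 2.
Proof. by case: Hin. Qed.

Lemma innerDr u v w : ⟨u, v + w⟩ = ⟨u, v⟩ + ⟨u, w⟩.
Proof. by rewrite innerC innerDl !(innerC u). Qed.

Lemma innerZr (a : R) u v : ⟨u, a *: v⟩ = a * ⟨u, v⟩.
Proof. by rewrite innerC innerZl innerC. Qed.

Lemma innerNl u v : ⟨- u, v⟩ = - ⟨u, v⟩.
Proof. by rewrite -scaleN1r innerZl mulN1r. Qed.

Lemma innerNr u v : ⟨u, - v⟩ = - ⟨u, v⟩.
Proof. by rewrite innerC innerNl innerC. Qed.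

Lemma innerBl u v w : ⟨u - v, w⟩ = ⟨u, w⟩ - ⟨v, w⟩.
Proof. by rewrite innerDl innerNl. Qed.

Lemma innerBr u v w : ⟨u, v - w⟩ = ⟨u, v⟩ - ⟨u, w⟩.
Proof. by rewrite innerDr innerNr. Qed.

Lemma inner0l v : ⟨0, v⟩ = 0.
Proof. by rewrite -(scale0r 0) innerZl mul0r. Qed.

Lemma inner0r v : ⟨v, 0⟩ = 0.
Proof. by rewrite innerC inner0l. Qed.

Lemma inner_suml (I : Type) (r : seq I) (u : I -> V) v :
  ⟨\sum_(i <- r) u i, v⟩ = \sum_(i <- r) ⟨u i, v⟩.
Proof.
elim/big_ind2: _ => [|a b c d <- <-|//]; first by rewrite inner0l.
by rewrite innerDl.
Qed.

Lemma sqr_normD u v : `|u + v| ^+ 2 = `|u| ^+ 2 + 2 * ⟨u, v⟩ + `|v| ^+ 2.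
Proof. rewrite -!inner_norm innerDl !innerDr (innerC v u); ring. Qed.

Lemma sqr_normB u v : `|u - v| ^+ 2 = `|u| ^+ 2 - 2 * ⟨u, v⟩ + `|v| ^+ 2.
Proof. rewrite -!inner_norm innerBl !innerBr (innerC v u); ring. Qed.

Lemma inner_le u v : ⟨u, v⟩ <= `|u| * `|v|.
Proof.
have [->|u0] := eqVneq u 0; first by rewrite inner0l normr0 mul0r.
have [->|v0] := eqVneq v 0; first by rewrite inner0r normr0 mulr0.
have nu : 0 < `|u| by rewrite normr_gt0.
have nv : 0 < `|v| by rewrite normr_gt0.
have := sqr_ge0 `|(`|v| *: u - `|u| *: v)|.
rewrite sqr_normB innerZl innerZr !normrZ !normr_id.
have -> : (`|v| * `|u|) ^+ 2 - 2 * (`|v| * (`|u| * ⟨u, v⟩)) + (`|u| * `|v|) ^+ 2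
  = 2 * (`|u| * `|v|) * (`|u| * `|v| - ⟨u, v⟩) by ring.
by rewrite pmulr_rge0 ?mulr_gt0// subr_ge0.
Qed.

Lemma norm_inner u v : `|⟨u, v⟩| <= `|u| * `|v|.
Proof.
rewrite ler_norml inner_le andbT lerNl -innerNl -(normrN u); exact: inner_le.
Qed.

(** Polarization reduces this to continuity of the norm. *)
Lemma cvg_inner (T : Type) (F : set_system T) {FF : Filter F} (u v : T -> V) a b :
  u @ F --> a -> v @ F --> b -> (fun t => ⟨u t, v t⟩) @ F --> ⟨a, b⟩.
Proof.
move=> ua vb.
have -> : (fun t => ⟨u t, v t⟩) =
  (fun t => 2^-1 * (`|u t + v t| ^+ 2 - `|u t| ^+ 2 - `|v t| ^+ 2)).
  by apply/funext => t; rewrite sqr_normD; field.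
have -> : ⟨a, b⟩ = 2^-1 * (`|a + b| ^+ 2 - `|a| ^+ 2 - `|b| ^+ 2).
  by rewrite sqr_normD; field.
have sq (w : T -> V) c : w @ F --> c -> `|w t| ^+ 2 @[t --> F] --> `|c| ^+ 2.
  by move=> wc; rewrite expr2; apply: cvgM; exact: cvg_norm.
apply: cvgMr; apply: cvgB; first by apply: cvgB; apply: sq => //; exact: cvgD.
exact: sq.
Qed.

Lemma is_derive_inner (u v : R -> V) (du dv : V) (t : R) :
  is_derive (t : R^o) (1 : R^o) u du -> is_derive (t : R^o) (1 : R^o) v dv ->
  is_derive t 1 (fun s => ⟨u s, v s⟩) (⟨du, v t⟩ + ⟨u t, dv⟩).
Proof.
move=> [du1 du2] [dv1 dv2].
have cu : (fun h : R => h^-1 *: (u (h + t) - u t)) @ 0^' --> du.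
  by rewrite -du2; have := du1; rewrite /derivable /derive;
  under eq_fun do rewrite /= /GRing.scale /= mulr1.
have cv : (fun h : R => h^-1 *: (v (h + t) - v t)) @ 0^' --> dv.
  by rewrite -dv2; have := dv1; rewrite /derivable /derive;
  under eq_fun do rewrite /= /GRing.scale /= mulr1.
have cv0 : v (h + t) @[h --> 0^'] --> v t.
  apply: (@cvg_comp _ _ _ (fun h : R => h + t) v _ (nbhs t)).
    have : (h + t)%R @[h --> (0 : R)^'] --> 0 + t.
      by apply: cvgD; [exact: nbhs_dnbhs|exact: cvg_cst].
    by rewrite add0r.
  exact: is_derive_cvg.
have C : (fun h : R => h^-1 *: (⟨u (h + t), v (h + t)⟩ - ⟨u t, v t⟩)) @ 0^'
   --> ⟨du, v t⟩ + ⟨u t, dv⟩.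
  have -> : (fun h : R => h^-1 *: (⟨u (h + t), v (h + t)⟩ - ⟨u t, v t⟩)) =
    (fun h => ⟨h^-1 *: (u (h + t) - u t), v (h + t)⟩ +
      ⟨u t, h^-1 *: (v (h + t) - v t)⟩).
    apply/funext => h; rewrite innerZl innerZr innerBl innerBr /GRing.scale /=; ring.
  apply: cvgD; apply: cvg_inner => //; exact: cvg_cst.
split.
  rewrite /derivable; under eq_fun do rewrite /= /GRing.scale /= mulr1.
  by apply/cvg_ex; eexists; exact: C.
rewrite /derive; under eq_fun do rewrite /= /GRing.scale /= mulr1.
by apply/cvg_lim => //.
Qed.
End InnerProduct.

(** * Limits along filters, Riesz representation, weak limits and Opial's lemma *)

Lemma cvg_near_ge {R : realType} (T : Type) (F : set_system T) {FF : ProperFilter F}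
  (u : T -> R) (a x : R) : u @ F --> a -> (\forall t \near F, x <= u t) -> x <= a.
Proof. by move=> ua xu; rewrite -(cvg_lim _ ua)//; apply: limr_ge => //; exact: cvgP ua. Qed.

Lemma cvg_near_le {R : realType} (T : Type) (F : set_system T) {FF : ProperFilter F}
  (u : T -> R) (a x : R) : u @ F --> a -> (\forall t \near F, u t <= x) -> a <= x.
Proof. by move=> ua xu; rewrite -(cvg_lim _ ua)//; apply: limr_le => //; exact: cvgP ua. Qed.

Lemma cvg_inj {R : realType} (T : Type) (F : set_system T) {FF : ProperFilter F}
  (u : T -> R) (a b : R) : u @ F --> a -> u @ F --> b -> a = b.
Proof. by move=> /cvg_lim <-// /cvg_lim <-. Qed.

Section WeakLimits.
Context {R : realType} {V : completeNormedModType R} {inner : V -> V -> R}.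
Hypothesis Hin : is_inner inner.
Local Notation "⟨ u , v ⟩" := (inner u v).

(** The representing vector is the minimizer of [J], whose first-order condition reads l = ⟨c, .⟩.
    By the parallelogram identity [Jpar] any minimizing sequence is Cauchy, so completeness provides
    the minimizer. *)
Lemma riesz_representation (l : V -> R) (M : R) :
  (forall y z, l (y + z) = l y + l z) -> (forall a y, l (a *: y) = a * l y) ->
  (forall y, `|l y| <= M * `|y|) -> exists c, forall y, l y = ⟨c, y⟩.
Proof.
move=> lD lZ lM.
pose J y := `|y| ^+ 2 - 2 * l y.
have Jlb y : - M ^+ 2 <= J y.
  have := lM y; rewrite ler_norml => /andP[_ h]; have := sqr_ge0 (`|y| - M).
  by rewrite /J; nra.
pose A := [set J y | y in [set: V]].
have infA : has_inf A.
  split; first by exists (J 0), 0.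
  by exists (- M ^+ 2) => _ [y _ <-].
pose d := inf A.
have Jd y : d <= J y by apply: ge_inf; [case: infA | exists y].
have Jpar y z : `|y - z| ^+ 2 = 2 * J y + 2 * J z - 4 * J (2^-1 *: (y + z)).
  rewrite /J !lZ !lD normrZ exprMn (sqr_normB Hin) (sqr_normD Hin) ger0_norm//; by field.
have /choice[w Jw] : forall n : nat, exists z, J z < d + n.+1%:R^-1.
  move=> n; have n0 : 0 < n.+1%:R^-1 :> R by rewrite invr_gt0.
  have [a [b _ ab] Jb] := inf_adherent n0 infA.
  by exists b; rewrite ab.
have wn (e : R) : 0 < e -> \forall n \near \oo, J (w n) < d + e.
  move=> e0; near=> n; apply: (lt_trans (Jw n)); rewrite ltrD2l.
  by near: n; exact: near_infty_natSinv_lt (PosNum e0).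
have : cvg (w @ \oo).
  apply/cauchy_cvgP/cauchy_ballP => e e0.
  have e20 : 0 < e ^+ 2 / 4 by rewrite divr_gt0// exprn_gt0.
  have W := wn _ e20.
  exists (w @` [set n | J (w n) < d + e ^+ 2 / 4], w @` [set n | J (w n) < d + e ^+ 2 / 4]) => /=.
    by split; apply: filterS W => n Wn; exists n.
  move=> [_ _] [[i /= Ji <-] [j /= Jj <-]]; rewrite -ball_normE /=.
  rewrite -(ltr_pXn2r (n := 2))// ?nnegrE ?normr_ge0 ?ltW// Jpar.
  have := Jd (2^-1 *: (w i + w j)); lra.
move=> /cvg_ex[c wc]; exists c => y.
(* Limit of J (w n + s y) - J (w n) >= - e along the minimizing sequence. *)
have key s : 0 <= 2 * s * (⟨c, y⟩ - l y) + s ^+ 2 * `|y| ^+ 2.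
  have cw : (fun n => 2 * s * (⟨w n, y⟩ - l y) + s ^+ 2 * `|y| ^+ 2) @ \oo
     --> 2 * s * (⟨c, y⟩ - l y) + s ^+ 2 * `|y| ^+ 2.
    apply: cvgD; last exact: cvg_cst.
    apply: cvgMr; apply: cvgB; last exact: cvg_cst.
    by apply: cvg_inner => //; exact: cvg_cst.
  apply/ler_addgt0Pr => e e0; rewrite -lerBlDr sub0r.
  apply: (cvg_near_ge cw).
  near=> n; have h : J (w n) < d + e by near: n; exact: wn.
  have := Jd (w n + s *: y); move: h; rewrite /J lD lZ (sqr_normD Hin) (innerZr Hin).
  by rewrite normrZ exprMn real_normK ?num_real//; lra.
pose B := `|y| ^+ 2; have B0 : 0 <= B by rewrite exprn_ge0.
pose X := ⟨c, y⟩ - l y.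
(* A near-optimal s: it turns the quadratic into a negative multiple of X^2; B + 1 in place of B
   keeps the denominator positive when y = 0. *)
have := key (- X / (B + 1)); rewrite -/B -/X.
have -> : 2 * (- X / (B + 1)) * X + (- X / (B + 1)) ^+ 2 * B =
   - (X ^+ 2 * ((B + 2) / (B + 1) ^+ 2)) by field; lra.
have k0 : 0 < (B + 2) / (B + 1) ^+ 2 by rewrite divr_gt0 ?exprn_gt0//; lra.
rewrite oppr_ge0 pmulr_lle0// => X0.
have : X == 0 by rewrite -sqrf_eq0 eq_le X0 sqr_ge0.
by rewrite subr_eq0 => /eqP.
Unshelve. all: by end_near. Qed.

Lemma bounded_ultra_cvg (T : Type) (F : set_system T) (u : T -> R) (M : R) :
  UltraFilter F -> F [set t | `|u t| <= M] -> exists a : R, u @ F --> a.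
Proof.
move=> UF FM.
have FI : F (u @^-1` `[- M, M]%classic).
  apply: filterS FM => t ut; rewrite /preimage /= in_itv /= -ler_norml; exact: ut.
have [a [_ ca]] := @segment_compact R (- M) M (fmap u F) _ FI.
exists a; apply/cvgrPdist_lt => e e0.
have [//|Fc] := in_ultra_setVsetC [set t | `|a - u t| < e] UF.
have [b [Fb]] := ca [set b | ~ `|a - b| < e] (ball a e) Fc (nbhsx_ballx _ _ e0).
by rewrite -ball_normE.
Qed.

(** Along an ultrafilter every bounded scalar family ⟨u t, y⟩ converges. The limits are linear and
    bounded in y, hence represented by a vector. This plays the role of weak compactness of
    balls. *)
Lemma bounded_weak_ultra_cvg (T : Type) (F : set_system T) (u : T -> V) (M : R) :
  UltraFilter F -> F [set t | `|u t| <= M] ->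
  exists c, forall y, ⟨u t, y⟩ @[t --> F] --> ⟨c, y⟩.
Proof.
move=> UF FM.
have /choice[l ul] : forall y, exists a : R, ⟨u t, y⟩ @[t --> F] --> a.
  move=> y; apply: (@bounded_ultra_cvg _ _ _ (M * `|y|)) => //.
  apply: filterS FM => t /= ut; apply: (le_trans (norm_inner Hin _ _)).
  exact: ler_wpM2r.
have [] := @riesz_representation l M.
- move=> y z; apply: cvg_inj (ul _) _; under eq_fun do rewrite (innerDr Hin).
  exact: cvgD.
- move=> a y; apply: cvg_inj (ul _) _; under eq_fun do rewrite (innerZr Hin).
  exact: cvgMr.
- move=> y; have un : (fun t => `|⟨u t, y⟩| : R) @ F --> (`|l y| : R) by exact: cvg_norm (ul y).
  apply: (cvg_near_le un).
  apply: filterS FM => t /= ut; apply: (le_trans (norm_inner Hin _ _)).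
  exact: ler_wpM2r.
by move=> c lc; exists c => y; rewrite -lc.
Qed.

(* Opial's lemma for arbitrary filters: convergence of |u t - c| to a limit for two weak ultralimits
   forces <u t, c - c'> to converge, hence c = c'. *)
Lemma opial (T : Type) (F : set_system T) (u : T -> V) (M : R) (S : set V) :
  ProperFilter F -> F [set t | `|u t| <= M] ->
  (forall z, S z -> cvg (`|u t - z| ^+ 2 @[t --> F])) ->
  (forall G c, UltraFilter G -> F `<=` G ->
     (forall y, ⟨u t, y⟩ @[t --> G] --> ⟨c, y⟩) -> S c) ->
  exists2 c, S c & forall y, ⟨u t, y⟩ @[t --> F] --> ⟨c, y⟩.
Proof.
move=> FF FM Fd FS.
have [G [UG FG]] := ultraFilterLemma FF.
have [c cG] := bounded_weak_ultra_cvg UG (FG _ FM).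
have Sc := FS _ _ UG FG cG; exists c => // y.
apply/cvgrPdist_lt => e e0; apply: contrapT => nF.
pose A := [set t | `|⟨c, y⟩ - ⟨u t, y⟩| < e].
(* If the limit failed, no member of [F] would lie inside [A]; so [F] extends to an ultrafilter that
   avoids [A] and has its own weak limit. *)
have PF : ProperFilter (filter_from F (fun B => B `&` ~` A)).
  apply: filter_from_proper.
    apply: filter_from_filter; first by exists setT; exact: filterT.
    move=> B C FB FC; exists (B `&` C); first exact: filterI.
    by move=> t [[? ?] ?]; split; split.
  move=> B FB; apply/set0P/eqP => BA; apply: nF; apply: filterS FB => t Bt.
  by apply: contrapT => nA; have : (B `&` ~` A) t by []; rewrite BA.
have [G' [UG' FG']] := ultraFilterLemma PF.
have FG2 : F `<=` G' by move=> B FB; apply: FG'; exists B => // t [].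
have G'A : G' (~` A) by apply: FG'; exists setT; [exact: filterT|move=> t []].
have [c' cG'] := bounded_weak_ultra_cvg UG' (FG2 _ FM).
have Sc' := FS _ _ UG' FG2 cG'.
have /cvg_ex[a ua] : cvg (⟨u t, c - c'⟩ @[t --> F]).
  have -> : (fun t => ⟨u t, c - c'⟩) = (fun t => 2^-1 * ((`|u t - c'| ^+ 2 - `|u t - c| ^+ 2)
     - (`|c'| ^+ 2 - `|c| ^+ 2))).
    by apply/funext => t; rewrite !(sqr_normB Hin) (innerBr Hin); field.
  apply: is_cvgMr; apply: is_cvgB; last exact: is_cvg_cst.
  by apply: is_cvgB; exact: Fd.
have a1 : a = ⟨c, c - c'⟩.
  by apply: cvg_inj (cG _) => //; apply: cvg_trans ua; exact: cvg_app.
have a2 : a = ⟨c', c - c'⟩.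
  by apply: cvg_inj (cG' _) => //; apply: cvg_trans ua; exact: cvg_app.
have cc' : c = c'.
  apply/eqP; rewrite -subr_eq0 -normr_eq0 -sqrf_eq0 -(inner_norm Hin).
  by rewrite (innerBl Hin) -a1 -a2 subrr.
have : G' A by have /cvgrPdist_lt := cG' y; rewrite -cc'; apply.
by move=> G'A'; have /filter_ex[t []] : G' (A `&` ~` A) by exact: filterI.
Qed.
End WeakLimits.

(** * Increments, continuous induction and monotonicity from an almost-everywhere derivative *)

(** A form without division that admits h = 0, so that increments on either side of t can be
    estimated directly. *)
Lemma is_deriveP {R : realType} {V : normedModType R} (v : R -> V) (dv : V) (t : R) :
  is_derive (t : R^o) (1 : R^o) v dv <->
  forall e : R, 0 < e -> exists2 d : R, 0 < d &
    forall h, `|h| < d -> `|v (t + h) - v t - h *: dv| <= e * `|h|.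
Proof.
have E : (fun h : R => h^-1 *: (v (h + t) - v t)) =
  (fun h : R^o => h^-1 *: ((v \o shift (t : R^o)) (h *: (1 : R^o)) - v t)).
  by apply/funext => h; rewrite /= /GRing.scale /= mulr1.
split.
  move=> [dv1 dv2] e e0.
  have : (fun h : R => h^-1 *: (v (h + t) - v t)) @ 0^' --> dv by rewrite E -dv2.
  move=> /cvgrPdist_le/(_ _ e0)[d /= d0 dP]; exists d => // h hd.
  have [->|h0] := eqVneq h 0; first by rewrite addr0 subrr scale0r subrr !normr0 mulr0.
  have := dP h; rewrite /= sub0r normrN => /(_ hd h0).
  have -> : v (t + h) - v t - h *: dv = - (h *: (dv - h^-1 *: (v (h + t) - v t))).
    by rewrite scalerBr scalerA divff// scale1r opprB (addrC h).
  by rewrite normrN normrZ mulrC => H; rewrite ler_wpM2r.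
move=> H.
have C : (fun h : R => h^-1 *: (v (h + t) - v t)) @ 0^' --> dv.
  apply/cvgrPdist_le => e e0; have [d d0 dP] := H e e0.
  exists d => //= h; rewrite /= sub0r normrN => hd h0.
  have := dP h hd.
  have -> : v (t + h) - v t - h *: dv = - (h *: (dv - h^-1 *: (v (h + t) - v t))).
    by rewrite scalerBr scalerA divff// scale1r opprB (addrC h).
  by rewrite normrN normrZ mulrC ler_pM2r ?normr_gt0.
rewrite E in C; split; first exact: cvgP C.
exact: cvg_lim C.
Qed.

(** At the supremum of the points where [P] holds, a single step from slightly before it lands
    beyond it, unless b is already reached. The step straddles t, so [P] need not be shown closed
    under limits separately. *)
Lemma continuous_induction {R : realType} (P : R -> Prop) (a b : R) : a <= b -> P a ->
  (forall t, a <= t <= b -> exists2 d : R, 0 < d & forall r s, a <= r -> s <= b ->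
     t - d < r -> r <= t -> t <= s -> s < t + d -> P r -> P s) -> P b.
Proof.
move=> ab Pa H; pose A := [set t | a <= t <= b /\ P t].
have Aa : A a by rewrite /A /= lexx ab.
have supA : has_sup A by split; [exists a | exists b => t [/andP[]]].
have aT : a <= sup A by apply: ub_le_sup => //; case: supA.
have Tb : sup A <= b by apply: ge_sup; [exists a|move=> t [/andP[]]].
have [|d d0 dP] := H (sup A); first by rewrite aT.
have [r [/andP[ar rb] Pr] rT] := sup_adherent d0 supA.
have rT' : r <= sup A by apply: ub_le_sup; [case: supA | split=> //; apply/andP].
pose s := Order.min b (sup A + d / 2).
have Ts : sup A <= s by rewrite le_min Tb lerDl; lra.
have sb : s <= b by rewrite ge_min lexx.
have Ps : P s.
  apply: (dP r s) => //; rewrite /s gt_min; apply/orP; right; lra.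
have sT : s <= sup A.
  apply: ub_le_sup; [by case: supA | split=> //; apply/andP; split=> //].
  exact: le_trans aT _.
suff -> : b = s by [].
have := lexx s; rewrite {2}/s; rewrite /s in sT *.
by rewrite /Order.min; case: ifP => // H1; move: sT; rewrite /Order.min H1; lra.
Qed.

(* An open set U of small measure covers the exceptional null set. Continuous induction moves from a to b;
   at exceptional points the step is an interval inside U, and the total increment over such intervals is
   small by absolute continuity of v. *)
Lemma ae_derive_le0_nincr {R : realType} {V : normedModType R} (v : R -> V)
    (phi : R -> R) (a b C : R) : a <= b -> abs_cont_on v a b -> 0 <= C ->
  (forall u w, a <= u -> u <= w -> w <= b ->
     `|phi w - phi u| <= C * (w - u + `|v w - v u|)) ->
  {ae (@lebesgue_measure R), forall t : R, a <= t ->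
     exists2 l : R, is_derive t 1 phi l & l <= 0} ->
  phi b <= phi a.
Proof.
move=> ab ACv C0 phiv [N [mN N0 NP]].
suff H (e : R) : 0 < e -> phi b - phi a <= e * (b - a + 2 * C).
  rewrite -subr_le0; apply/ler_addgt0Pr => e e0; rewrite add0r.
  have k0 : 0 < b - a + 2 * C + 1 by lra.
  have := H (e / (b - a + 2 * C + 1)) (divr_gt0 e0 k0) => /le_trans; apply.
  by rewrite -mulrA ger_pMr// mulrC ler_pdivrMr//; lra.
move=> e0; have [d d0 dP] := ACv e e0.
(* Two budgets for the bad intervals: d bounds the variation of v over them by e, and e bounds their
   total length, which also enters the estimate on phi. *)
pose d' := Order.min d e.
have d'0 : 0 < d' by rewrite lt_min d0.
pose mu : {measure set (measurableTypeR R) -> \bar R} := @lebesgue_measure R.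
have [U [oU NU muU]] : exists U : set R, [/\ open U, N `<=` U & (mu U < d'%:E)%E].
  have Nfin : (mu N < +oo)%E by rewrite (N0 : mu N = 0%E) ltry.
  have [U [oU NU muU]] := lebesgue_regularity_outer mN Nfin d'0.
  exists U; split=> //.
  have mU : measurable U by exact: measurable_realfun.open_measurable.
  rewrite -(setDUK NU). rewrite measureU//=; last 2 first.
    exact: measurableD.
    by rewrite setDE setICA setICr setI0.
  by rewrite (N0 : mu N = 0%E) add0e.
have mU : measurable U by exact: measurable_realfun.open_measurable.
have mle (A B : set R) : measurable A -> measurable B -> A `<=` B -> (mu A <= mu B)%E.
  by move=> mA mB AB; apply: le_measure; rewrite ?inE.
have mUI (I : interval R) : measurable (U `&` [set` I]) by exact: measurableI.
(* The measure of U consumed up to t; it caps the total length of the bad intervals collected so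
   far. *)
pose m (t : R) := fine (mu (U `&` `[a, t])).
have muE (t : R) : (m t)%:E = mu (U `&` `[a, t]).
  rewrite fineK// ge0_fin_numE// (@le_lt_trans _ _ (mu U))//; last first.
    exact: lt_trans muU (ltry _).
  by apply: mle; [exact: mUI|exact: mU|exact: subIsetl].
have m_ge0 t : 0 <= m t by exact: fine_ge0.
have mb : m b < d'.
  rewrite -lte_fin muE; apply: le_lt_trans muU.
  by apply: mle; [exact: mUI|exact: mU|exact: subIsetl].
have m_ndecr r s : r <= s -> m r <= m s.
  move=> rs; rewrite -lee_fin !muE; apply: mle; [exact: mUI|exact: mUI|].
  by apply: setIS; apply: subset_itvl; rewrite bnd_simp.
have m_incr r s : a <= r -> r <= s -> `[r, s] `<=` U -> m r + (s - r) <= m s.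
  move=> ar rs rsU; rewrite -lee_fin EFinD !muE.
  have -> : (s - r)%:E = mu `]r, s].
    apply/esym/(etrans (lebesgue_measure_itv _)); rewrite /= lte_fin.
    by case: ltgtP rs => // -> _; rewrite subrr.
  rewrite -measureU//=; last 2 first.
  - exact: mUI.
  - rewrite -subset0 => z [[_]] /=; rewrite !in_itv /= => /andP[_ zr] /andP[rz _].
    by have := lt_le_trans rz zr; rewrite ltxx.
  apply: mle; [by apply: measurableU => //; exact: mUI|exact: mUI|].
  move=> z [[Uz]|] /=; rewrite !in_itv /= => /andP[az zr]; split=> //=.
  - by rewrite az (le_trans zr).
  - by apply: rsU; rewrite /= in_itv /= ltW.
  - by rewrite zr andbT (le_trans ar)// ltW.
(* The invariant carries the ordered list of bad intervals used up to t, in the format that absolute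
   continuity accepts; the rest of [a, t] costs slope e. *)
pose P t := exists n (u w : nat -> R),
  [/\ forall k, (k < n)%N -> a <= u k <= w k /\ w k <= t,
      forall k, (k.+1 < n)%N -> w k <= u k.+1,
      \sum_(k < n) (w k - u k) <= m t &
      phi t - phi a <= e * (t - a) +
        \sum_(k < n) C * (w k - u k + `|v (w k) - v (u k)|)].
have Pslow r s : r <= s -> phi s - phi r <= e * (s - r) -> P r -> P s.
  move=> rs ers [n [u [w [H1 H2 H3 H4]]]]; exists n, u, w; split => //.
  - by move=> k kn; have [? ?] := H1 k kn; split=> //; exact: le_trans rs.
  - exact: le_trans H3 (m_ndecr _ _ rs).
  - by move: H4; lra.
have Pbad r s : a <= r -> r <= s -> s <= b -> `[r, s] `<=` U -> P r -> P s.
  move=> ar rs sb rsU [n [u [w [H1 H2 H3 H4]]]].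
  exists n.+1, (fun k => if (k < n)%N then u k else r), (fun k => if (k < n)%N then w k else s).
  split.
  - move=> k; rewrite ltnS => kn; case: ifPn => kn'; last by rewrite ar rs.
    by have [? ?] := H1 k kn'; split => //; exact: le_trans rs.
  - move=> k; rewrite ltnS => kn; rewrite kn; case: ifPn => kn'; first exact: H2.
    by have [] := H1 k kn.
  - rewrite big_ord_recr /= ltnn.
    under eq_bigr do rewrite ltn_ord.
    exact: le_trans (lerD H3 (lexx _)) (m_incr _ _ ar rs rsU).
  - rewrite big_ord_recr /= ltnn.
    under eq_bigr do rewrite ltn_ord.
    have := phiv r s ar rs sb; rewrite ler_norml => /andP[_].
    have : 0 <= e * (s - r) by apply: mulr_ge0; [exact: ltW|lra].
    by move: H4; lra.
have [n [u [w [H1 H2 H3 H4]]]] : P b.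
  apply: (continuous_induction ab).
    exists 0%N, (fun=> 0), (fun=> 0); split => //; rewrite big_ord0//.
    by rewrite !subrr mulr0 addr0.
  move=> t /andP[at_ tb]; have [Ut|nUt] := pselect (U t).
    have [d1 /= d10 d1U] := oU t Ut; exists d1 => // r s ar sb tr rt ts st.
    apply: Pbad => //; first exact: le_trans ts.
    move=> z; rewrite /= in_itv /= => /andP[rz zs]; apply: d1U => /=.
    by rewrite ltr_norml; apply/andP; split; lra.
  have [l pl l0] : exists2 l : R, is_derive t 1 phi l & l <= 0.
    by apply: contrapT => H; apply/nUt/NU/NP => /= /(_ at_).
  have [d1 d10 d1P] := (is_deriveP _ _ _).1 pl e e0.
  exists d1 => // r s ar sb tr rt ts st Pr.
  (* Differentiability at t compares values with [phi t] only, so the step from r to s is split at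
     t. *)
  apply: (Pslow t) => //.
    have := d1P (s - t); rewrite subrKC ger0_norm ?subr_ge0//   => H.
    have {H} := H ltac:(lra).
    rewrite ler_norml => /andP[_]; rewrite /GRing.scale /=.
    have : (s - t) * l <= 0 by rewrite mulr_ge0_le0// subr_ge0.
    by lra.
  apply: (Pslow r) => //.
  have := d1P (r - t); rewrite subrKC ler0_norm ?subr_le0//   => H.
  have {H} := H ltac:(lra).
  rewrite ler_norml => /andP[+ _]; rewrite /GRing.scale /=.
  have : 0 <= (r - t) * l by rewrite mulr_le0// subr_le0.
  by lra.
have S1 : \sum_(k < n) (w k - u k) < d.
  by apply: (le_lt_trans H3); apply: (lt_le_trans mb); rewrite ge_min lexx.
have S2 : \sum_(k < n) (w k - u k) < e.
  by apply: (le_lt_trans H3); apply: (lt_le_trans mb); rewrite ge_min lexx orbT.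
have S3 := dP n u w H1 H2 S1.
apply: (le_trans H4); rewrite -mulr_sumr big_split /=.
have : \sum_(k < n) (w k - u k) + \sum_(k < n) `|v (w k) - v (u k)| <= e * 2 by lra.
by move=> /(ler_wpM2l C0); lra.
Qed.

(** * Calculus and asymptotics for real functions on a half-line *)

Section RealLemmas.
Context {R : realType}.
Implicit Types (f g df dg : R -> R) (t : R).

Lemma is_derive_add f g t (a b : R) : is_derive t 1 f a -> is_derive t 1 g b ->
  is_derive t 1 (fun s => f s + g s) (a + b).
Proof. by move=> fa gb; exact: is_deriveD. Qed.

Lemma is_derive_mul f g t (a b : R) : is_derive t 1 f a -> is_derive t 1 g b ->
  is_derive t 1 (fun s => f s * g s) (a * g t + f t * b).
Proof.
move=> fa gb; apply: is_derive_eq (is_deriveM fa gb) _.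
by rewrite /GRing.scale /= addrC mulrC.
Qed.

Lemma is_derive_scale f t (c a : R) : is_derive t 1 f a ->
  is_derive t 1 (fun s => c * f s) (c * a).
Proof. by move=> fa; exact: is_deriveZ. Qed.

Lemma is_derive_opp f t (a : R) : is_derive t 1 f a -> is_derive t 1 (fun s => - f s) (- a).
Proof. by move=> fa; exact: is_deriveN. Qed.

Lemma is_derive_powR (r t : R) : 0 < t ->
  is_derive t 1 (fun s => s `^ r) (r * t `^ (r - 1)).
Proof. by move=> t0; exact: is_derive1_powR. Qed.

Lemma is_derive_continuous f t (a : R) : is_derive t 1 f a -> {for t, continuous f}.
Proof. exact: is_derive_cvg. Qed.

Lemma continuous_within f (a b : R) :
  (forall t, a <= t <= b -> {for t, continuous f}) -> {within `[a, b], continuous f}.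
Proof.
move=> cf; apply: continuous_in_subspaceT => t; rewrite inE /= in_itv /=; exact: cf.
Qed.

Lemma mean_value f df (a b : R) : a <= b ->
  (forall t, a <= t <= b -> is_derive t 1 f (df t)) ->
  exists2 c, a <= c <= b & f b - f a = df c * (b - a).
Proof.
move=> ab fd; have [||c cab E] := @MVT_segment R f df a b ab.
- by move=> t; rewrite in_itv /= => /andP[/ltW at_ /ltW tb]; apply: fd; rewrite at_.
- by apply: continuous_within => t tab; exact: is_derive_continuous (fd t tab).
by exists c; rewrite // -in_itv in cab *.
Qed.

Lemma derive_le0_nincr f df (a : R) :
  (forall t, a <= t -> is_derive t 1 f (df t)) -> (forall t, a <= t -> df t <= 0) ->
  forall s t, a <= s -> s <= t -> f t <= f s.
Proof.
move=> fd df0 s t as_ st.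
have [|c /andP[sc _] E] := mean_value st (df := df) (f := f).
  by move=> u /andP[su _]; apply: fd; exact: le_trans su.
by rewrite -subr_le0 E mulr_le0_ge0 ?subr_ge0// df0// (le_trans as_).
Qed.

(** The fundamental theorem gives the derivative at interior points; to have it at t0 itself, the
    integral is later started at t0 / 2. *)
Lemma exists_antiderivative f (a : R) : (forall t, a <= t -> {for t, continuous f}) ->
  exists K : R -> R, forall t, a < t -> is_derive t 1 K (f t).
Proof.
move=> cf; exists (fun x => \int[lebesgue_measure]_(t in [set` `[a, x]]) (f t))%R => t at_.
have [||F1 F2] := @continuous_FTC1_closed R f a t (t + 1) _ _ at_ (cf _ (ltW at_)).
- by rewrite ltrDl.
- apply: continuous_compact_integrable; first exact: segment_compact.
  by apply: continuous_within => u /andP[au _]; exact: cf.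
by split; [exact: F1|rewrite -derive1E; exact: F2].
Qed.

Lemma cvgr_pinftyP f (l : R) : f t @[t --> +oo] --> l <->
  forall e : R, 0 < e -> exists T, forall t, T <= t -> `|f t - l| <= e.
Proof.
split=> [/cvgrPdist_le H e e0|H].
  have [T [_ TP]] := H e e0; exists (T + 1) => t Tt.
  by rewrite distrC; apply: TP; rewrite (lt_le_trans _ Tt)// ltrDl.
apply/cvgrPdist_le => e e0; have [T TP] := H e e0.
by exists T; split=> [|t Tt]; [exact: num_real|rewrite distrC TP// ltW].
Qed.

Lemma nincr_cvg f (a b : R) : (forall s t, a <= s -> s <= t -> f t <= f s) ->
  (forall t, a <= t -> b <= f t) ->
  exists2 l : R, f t @[t --> +oo] --> l & forall t, a <= t -> l <= f t.
Proof.
move=> fm fb; pose A := [set f t | t in [set t | a <= t]].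
have iA : has_inf A.
  by split; [exists (f a), a => //=|exists b => _ [t /= at_ <-]; exact: fb].
have Al t : a <= t -> inf A <= f t by move=> at_; apply: ge_inf; [case: iA|exists t].
exists (inf A) => //; apply/cvgr_pinftyP => e e0.
have [_ [T /= aT <-] fT] := inf_adherent e0 iA.
exists T => t Tt; have := Al t (le_trans aT Tt); have := fm _ _ aT Tt => H1 H2.
by rewrite ger0_norm; lra.
Qed.

Lemma ndecr_cvg f (a b : R) : (forall s t, a <= s -> s <= t -> f s <= f t) ->
  (forall t, a <= t -> f t <= b) ->
  exists2 l : R, f t @[t --> +oo] --> l & forall t, a <= t -> f t <= l.
Proof.
move=> fm fb; have [||l fl H] := @nincr_cvg (fun t => - f t) a (- b).
- by move=> s t as_ st; rewrite lerN2 fm.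
- by move=> t at_; rewrite lerN2 fb.
exists (- l); last by move=> t /H; rewrite lerNr.
have E : f = (fun t => - - f t) by apply/funext => t; rewrite opprK.
by rewrite E; exact: cvgN fl.
Qed.

Lemma near_ge (a : R) : \forall t \near +oo, a <= t.
Proof. by apply: nbhs_pinfty_ge; exact: num_real. Qed.

Lemma powR_unbounded (r B : R) : 0 < r -> exists2 T, 0 < T & forall t, T <= t -> B <= t `^ r.
Proof.
move=> r0; exists ((`|B| + 1) `^ r^-1); first by rewrite powR_gt0// ltr_wpDl.
move=> t Tt; have t0 : 0 <= t by apply: le_trans Tt; exact: powR_ge0.
have : ((`|B| + 1) `^ r^-1) `^ r <= t `^ r.
  by apply: ge0_ler_powR => //; rewrite ?nnegrE ?powR_ge0//; exact: ltW.
rewrite -powRrM mulVf ?gt_eqF// powRr1 ?addr_ge0// => /(le_trans _); apply.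
by have := ler_norm B; lra.
Qed.

Lemma powRN_cvg0 (r : R) : r < 0 -> t `^ r @[t --> +oo] --> (0 : R).
Proof.
move=> r0; apply/cvgr_pinftyP => e e0.
have [|T T0 TP] := @powR_unbounded (- r) e^-1; first by rewrite oppr_gt0.
exists T => t Tt; rewrite subr0 ger0_norm ?powR_ge0// -(opprK r) powRN.
have tr : 0 < t `^ (- r) by rewrite powR_gt0// (lt_le_trans T0).
by rewrite invf_ple ?posrE// TP.
Qed.

Lemma powR_nincr (r s t : R) : r <= 0 -> 0 < s -> s <= t -> t `^ r <= s `^ r.
Proof.
move=> r0 s0 st; have E u : u `^ r = (u `^ (- r))^-1 by rewrite powRN invrK.
rewrite !E lef_pV2 ?posrE ?powR_gt0 ?(lt_le_trans s0)//.
by apply: ge0_ler_powR; rewrite ?nnegrE ?oppr_ge0 ?(ltW s0)// (le_trans (ltW s0)).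
Qed.

(* With the integrating factor mu = exp (alpha t^(1-q) / (1-q)), mu (h - l / alpha - e) is eventually
   nonincreasing, whereas mu tends to +oo. *)
Lemma limsup_le_of_damped (t0 alpha q l : R) (h hd : R -> R) :
  0 < t0 -> 0 < alpha -> q < 1 ->
  (forall t, t0 <= t -> is_derive t 1 h (hd t)) ->
  t `^ q * hd t + alpha * h t @[t --> +oo] --> l ->
  forall e : R, 0 < e -> exists T, forall t, T <= t -> h t - l / alpha <= e.
Proof.
move=> t00 al0 q1 dh cl e e0.
have e20 : 0 < e / 2 by rewrite divr_gt0.
have [T1 T1P] := (cvgr_pinftyP _ _).1 cl (alpha * (e / 2)) (mulr_gt0 al0 e20).
pose T := Order.max T1 t0.
pose c := alpha / (1 - q).
have c0 : 0 < c by rewrite divr_gt0 ?subr_gt0.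
pose mu (t : R) := expR (c * t `^ (1 - q)).
have dmu t : t0 <= t -> is_derive t 1 mu (alpha * t `^ (- q) * mu t).
  move=> t0t; have tp := lt_le_trans t00 t0t.
  have D := is_derive_scale c (is_derive_powR (1 - q) tp).
  have E := @is_derive1_comp R expR (fun s => c * s `^ (1 - q)) t _ _ (is_derive_expR _) D.
  apply: is_derive_eq E _; rewrite /GRing.scale /= /mu /c.
  have -> : 1 - q - 1 = - q by ring.
  by field; rewrite subr_eq0 gt_eqF.
pose F t := mu t * (h t - (l / alpha + e / 2)).
pose dF_ (t : R) := (alpha * t `^ (- q) * mu t * (h t - (l / alpha + e / 2)) + mu t * (hd t + 0)).
have dF t : t0 <= t -> is_derive t 1 F (dF_ t).
  move=> t0t; apply: is_derive_mul; first exact: dmu.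
  by apply: is_derive_add; exact: dh.
have Fm : forall s t, T <= s -> s <= t -> F t <= F s.
  apply: (@derive_le0_nincr F dF_).
    by move=> t; rewrite ge_max => /andP[_]; exact: dF.
  move=> t; rewrite ge_max => /andP[/T1P + t0t]; have tp := lt_le_trans t00 t0t.
  rewrite ler_norml => /andP[_ H]; rewrite /dF_ addr0 powRN.
  have tq : 0 < t `^ q by exact: powR_gt0.
  have -> : alpha * (t `^ q)^-1 * mu t * (h t - (l / alpha + e / 2)) + mu t * hd t =
    (mu t / t `^ q) * (t `^ q * hd t + alpha * h t - l - alpha * (e / 2)).
    by field; rewrite !gt_eqF.
  apply: mulr_ge0_le0; last by lra.
  by rewrite divr_ge0 ?expR_ge0// ltW.
(* Beyond [T2], exp u > 1 + u gives mu t * (e / 2) >= |F T|, which no value above the claimed bound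
   survives. *)
have [T2 T20 T2P] := @powR_unbounded (1 - q) (`|F T| / (e / 2) / c) (ltac:(by rewrite subr_gt0)).
exists (Order.max T T2) => t; rewrite ge_max => /andP[Tt T2t].
have := Fm _ _ (lexx _) Tt; rewrite {1}/F => Ft.
have mu1 : `|F T| / (e / 2) <= mu t.
  apply: le_trans (ltW (expR_gt1Dx _)); last first.
    by rewrite gt_eqF// mulr_gt0// powR_gt0// (lt_le_trans T20).
  have := T2P t T2t; rewrite ler_pdivrMr// mulrC; lra.
have mu0 : 0 < mu t by exact: expR_gt0.
rewrite ler_pdivrMr// in mu1.
rewrite leNgt; apply/negP => H.
have : mu t * (e / 2) < mu t * (h t - (l / alpha + e / 2)) by rewrite ltr_pM2l//; lra.
have := ler_norm (F T); lra.
Qed.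

Lemma cvg_of_damped (t0 alpha q l : R) (h hd : R -> R) :
  0 < t0 -> 0 < alpha -> q < 1 ->
  (forall t, t0 <= t -> is_derive t 1 h (hd t)) ->
  t `^ q * hd t + alpha * h t @[t --> +oo] --> l ->
  h t @[t --> +oo] --> l / alpha.
Proof.
move=> t00 al0 q1 dh cl; apply/cvgr_pinftyP => e e0.
have [T1 H1] := limsup_le_of_damped t00 al0 q1 dh cl e0.
have [||T2 H2] := @limsup_le_of_damped t0 alpha q (- l) (fun t => - h t) (fun t => - hd t) t00 al0 q1 _ _ e e0.
- by move=> t /dh; exact: is_derive_opp.
- by under eq_fun do rewrite !mulrN -opprD; exact: cvgN.
exists (Order.max T1 T2) => t; rewrite ge_max => /andP[/H1 h1 /H2 h2].
by rewrite ler_norml; apply/andP; split; move: h1 h2; rewrite ?mulNr; lra.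
Qed.

(** As e grows at rate at most B, a late value above d forces e >= d / 2 on the preceding interval
    of length eta = d / (2 B). There L gains at least c (d / 2) eta, against its convergence.
    Looking backward, a one-sided growth bound is enough. *)
Lemma barbalat (t0 c B b : R) (L dL e : R -> R) :
  0 < c -> 0 < B -> (forall t, t0 <= t -> is_derive t 1 L (dL t)) ->
  (forall t, t0 <= t -> c * e t <= dL t) -> (forall t, t0 <= t -> 0 <= e t) ->
  (forall t, t0 <= t -> L t <= b) ->
  (forall s t, t0 <= s -> s <= t -> e t - e s <= B * (t - s)) ->
  e t @[t --> +oo] --> (0 : R).
Proof.
move=> c0 B0 dL_ ce e_ge0 Lb elip.
have Lm s t : t0 <= s -> s <= t -> L s <= L t.
  move=> s0 st; have [u /andP[su ut] E] := mean_value st (fun u uI => dL_ u (le_trans s0 (andP uI).1)).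
  rewrite -subr_ge0 E mulr_ge0 ?subr_ge0// (le_trans _ (ce _ _)) ?(le_trans s0)//.
  by rewrite mulr_ge0 ?(ltW c0)// e_ge0// (le_trans s0).
have [l Ll lL] := ndecr_cvg Lm Lb.
apply/cvgr_pinftyP => d d0.
pose eta := d / (2 * B).
have eta0 : 0 < eta by rewrite divr_gt0// mulr_gt0.
(* Half of the forced gain: beyond [T], L is within this distance below its limit. *)
have k0 : 0 < c * (d / 2) * eta / 2 by rewrite divr_gt0// mulr_gt0// mulr_gt0// divr_gt0.
have [T TP] := (cvgr_pinftyP _ _).1 Ll _ k0.
exists (Order.max T t0 + eta) => t Tt.
set T' := Order.max T t0 in Tt.
have T'T : T <= T' by rewrite le_max lexx.
have T't0 : t0 <= T' by rewrite le_max lexx orbT.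
rewrite subr0 ger0_norm ?e_ge0//; last by lra.
rewrite leNgt; apply/negP => det.
have st : t - eta <= t by lra.
have [u /andP[su ut] E] := mean_value st (fun u uI => dL_ u (le_trans (ltac:(lra) : t0 <= t - eta) (andP uI).1)).
have u0 : t0 <= u by lra.
have eu : d / 2 <= e u.
  have := elip u t u0 ut; have : B * (t - u) <= B * eta by rewrite ler_pM2l//; lra.
  have -> : B * eta = d / 2 by rewrite /eta; field; rewrite gt_eqF.
  by lra.
have : c * (d / 2) * eta <= L t - L (t - eta).
  rewrite E; have -> : t - (t - eta) = eta by ring.
  rewrite ler_pM2r//; apply: le_trans (ce u u0); by rewrite ler_pM2l.
have := lL t (ltac:(lra)).
have := TP (t - eta) (ltac:(lra)); rewrite ler_norml => /andP[]; lra.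
Qed.

End RealLemmas.

(* The increments of phi are controlled by those of the identity and of v: on [a, b] this makes phi absolutely
   continuous when v is, and unlike a composition with v it is stable under sums and products. *)
Definition dominated {R : realType} {V : normedModType R} (v : R -> V) (a b : R)
    (phi : R -> R) : Prop :=
  exists2 C : R, 0 <= C & forall u w, a <= u -> u <= w -> w <= b ->
    `|phi w - phi u| <= C * (w - u + `|v w - v u|).

(** * Stability of domination, and the resulting monotonicity criterion *)

Section Dominated.
Context {R : realType} {V : normedModType R} (v : R -> V).
Implicit Types (phi psi : R -> R) (a b : R).

Lemma dominated_lipschitz phi a b (C : R) : 0 <= C ->
  (forall u w, a <= u -> u <= w -> w <= b -> `|phi w - phi u| <= C * (w - u)) ->
  dominated v a b phi.
Proof.
move=> C0 H; exists C => // u w au uw wb; apply: (le_trans (H u w au uw wb)).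
by rewrite ler_wpM2l// lerDl.
Qed.

Lemma dominated_cst (c : R) a b : dominated v a b (fun=> c).
Proof. by exists 0 => // u w _ _ _; rewrite subrr normr0 mul0r. Qed.

Lemma dominated_add phi psi a b : dominated v a b phi -> dominated v a b psi ->
  dominated v a b (fun t => phi t + psi t).
Proof.
move=> [C C0 HC] [D D0 HD]; exists (C + D); first exact: addr_ge0.
move=> u w au uw wb; rewrite mulrDl.
have -> : phi w + psi w - (phi u + psi u) = (phi w - phi u) + (psi w - psi u) by ring.
by apply: (le_trans (ler_normD _ _)); rewrite lerD ?HC ?HD.
Qed.

Lemma continuous_bounded (f : R -> R) a b : (forall t, a <= t <= b -> {for t, continuous f}) ->
  exists2 B : R, 0 <= B & forall t, a <= t <= b -> `|f t| <= B.
Proof.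
move=> cf; have [ab|ba] := leP a b; last first.
  by exists 0 => // t /andP[at_ tb]; have := le_trans at_ tb; rewrite leNgt ba.
have [|c cab cP] := @EVT_max R (fun t => `|f t|) a b ab.
  by apply: continuous_within => t tab; apply: cvg_norm; exact: cf.
by exists `|f c| => // t tab; apply: cP; rewrite in_itv.
Qed.

Lemma dominated_bounded phi a b : continuous v -> dominated v a b phi ->
  exists2 B : R, 0 <= B & forall t, a <= t <= b -> `|phi t| <= B.
Proof.
move=> cv [C C0 HC].
have [|B B0 BP] := @continuous_bounded (fun t => `|v t - v a|) a b.
  move=> t _; apply: (@cvg_norm _ _ _ _ _ (fun t => v t - v a)).
  by apply: cvgB; [exact: cv|exact: cvg_cst].
exists (`|phi a| + C * (`|b - a| + B)); first by rewrite addr_ge0// mulr_ge0// addr_ge0.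
move=> t /andP[at_ tb].
have -> : phi t = phi a + (phi t - phi a) by ring.
apply: (le_trans (ler_normD _ _)); rewrite lerD2l.
apply: (le_trans (HC a t (lexx _) at_ tb)); rewrite ler_wpM2l//.
have := BP t; rewrite at_ tb normr_id => /(_ isT); have := ler_norm (b - a); lra.
Qed.

Lemma dominated_mul phi psi a b : continuous v -> dominated v a b phi -> dominated v a b psi ->
  dominated v a b (fun t => phi t * psi t).
Proof.
move=> cv dphi dpsi.
have [B B0 HB] := dominated_bounded cv dphi; have [B' B'0 HB'] := dominated_bounded cv dpsi.
move: dphi dpsi => [C C0 HC] [D D0 HD]; exists (B' * C + B * D).
  by rewrite addr_ge0// mulr_ge0.
move=> u w au uw wb.
have -> : phi w * psi w - phi u * psi u =
  psi w * (phi w - phi u) + phi u * (psi w - psi u) by ring.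
apply: (le_trans (ler_normD _ _)); rewrite !normrM mulrDl -!mulrA.
by apply: lerD; apply: ler_pM => //; do ?[exact: HC|exact: HD|apply: HB; lra|apply: HB'; lra];
  apply/andP; split=> //; lra.
Qed.

Lemma dominated_scale (c : R) phi a b : continuous v -> dominated v a b phi ->
  dominated v a b (fun t => c * phi t).
Proof. by move=> cv dphi; apply: dominated_mul => //; exact: dominated_cst. Qed.

Lemma dominated_C1 phi (dphi : R -> R) a b :
  (forall t, a <= t <= b -> is_derive t 1 phi (dphi t)) ->
  (forall t, a <= t <= b -> {for t, continuous dphi}) -> dominated v a b phi.
Proof.
move=> dP /continuous_bounded[B B0 BP]; apply: (@dominated_lipschitz _ _ _ B) => //.
move=> u w au uw wb.
have [|c /andP[uc cw] ->] := @mean_value R phi dphi u w uw.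
  by move=> t /andP[ut tw]; apply: dP; apply/andP; split; lra.
by rewrite normrM (ger0_norm (_ : 0 <= w - u)) ?subr_ge0// ler_wpM2r ?subr_ge0// BP//;
  apply/andP; split; lra.
Qed.

Lemma dominated_powR (r a b : R) : 0 < a -> dominated v a b (fun t => t `^ r).
Proof.
move=> a0; apply: (@dominated_C1 _ (fun t => r * t `^ (r - 1))) => t /andP[at_ _].
  by apply: is_derive_powR; exact: lt_le_trans at_.
apply: (@is_derive_continuous _ _ _ (r * ((r - 1) * t `^ (r - 1 - 1)))).
by apply: is_derive_scale; apply: is_derive_powR; exact: lt_le_trans at_.
Qed.

(** Regularity is recorded from t0 on, the sign of the derivative only from T1, because several
    decay estimates hold only eventually. *)
Lemma dominated_nincr (t0 T1 : R) phi :
  (forall T, t0 <= T -> abs_cont_on v t0 T) ->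
  (forall T, t0 <= T -> dominated v t0 T phi) -> t0 <= T1 ->
  {ae (@lebesgue_measure R), forall t : R, T1 <= t ->
     exists2 l : R, is_derive t 1 phi l & l <= 0} ->
  forall s t, T1 <= s -> s <= t -> phi t <= phi s.
Proof.
move=> ACv dom t0T1 phiv s t T1s st.
have t0s : t0 <= s by lra.
have [C C0 CP] := dom t (le_trans t0s st).
apply: (@ae_derive_le0_nincr R V v phi s t C st) => //.
- move=> e e0; have [d d0 dP] := ACv t (le_trans t0s st) e e0; exists d => // n u w H1.
  by apply: dP => k kn; have [/andP[su uw] wt] := H1 k kn; rewrite (le_trans t0s su) uw.
- by move=> u w su; apply: CP; lra.
- apply: filterS phiv; first exact: (ae_filter_ringOfSetsType (@lebesgue_measure R)).
  by move=> z H sz; apply: H; lra.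
Qed.

End Dominated.

(** * Lyapunov analysis of the scalar second-order differential inequality *)

Section Lyapunov.
Context {R : realType} {V : normedModType R} (v : R -> V).
Context (t0 alpha q p C H : R) (h hd k L e : R -> R).
Hypotheses (t00 : 0 < t0) (al0 : 0 < alpha) (q0 : 0 < q) (q1 : q < 1) (qp : q + 1 < p) (C0 : 0 <= C).
Hypotheses (cv : continuous v) (ACv : forall T, t0 <= T -> abs_cont_on v t0 T).
Hypotheses (dom_h : forall T, t0 <= T -> dominated v t0 T h)
  (dom_hd : forall T, t0 <= T -> dominated v t0 T hd)
  (dom_k : forall T, t0 <= T -> dominated v t0 T k)
  (dom_L : forall T, t0 <= T -> dominated v t0 T L).
Hypotheses (dh : forall t, t0 <= t -> is_derive t 1 h (hd t))
  (dk : forall t, t0 <= t -> is_derive t 1 k (- (alpha / t `^ q * e t)))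
  (dL : forall t, t0 <= t -> is_derive t 1 L (t `^ q * e t)).
Hypotheses (h_ge0 : forall t, t0 <= t -> 0 <= h t) (h_le : forall t, t0 <= t -> h t <= H)
  (k_ge0 : forall t, t0 <= t -> 0 <= k t) (e_ge0 : forall t, t0 <= t -> 0 <= e t).
Hypothesis ode : {ae (@lebesgue_measure R), forall t : R, t0 <= t ->
  exists2 hdd : R, is_derive t 1 hd hdd &
    hdd + alpha / t `^ q * hd t <= 3 / 2 * e t - k t + C / t `^ p}.

(** An antiderivative of t^q (h'' + alpha t^(-q) h') up to a remainder: the term q t^(q-1) h comes
    from integrating by parts against the derivative of t^q, and leaves q (1 - q) t^(q-2) h.
    Bounding h by H there gives the last term of [E]. *)
Let P (t : R) := t `^ q * hd t + alpha * h t - q * (t `^ (q - 1) * h t).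
Let E (t : R) := 3 / 2 * (t `^ q * e t) - t `^ q * k t + C * t `^ (q - p)
  + q * (1 - q) * H * t `^ (q - 2).

Let pos t : t0 <= t -> 0 < t. Proof. exact: lt_le_trans. Qed.

Let dP : {ae (@lebesgue_measure R), forall t : R, t0 <= t ->
  exists2 l : R, is_derive t 1 P l & l <= E t}.
Proof.
apply: filterS ode; first exact: (ae_filter_ringOfSetsType (@lebesgue_measure R)).
move=> t /[swap] t0t /(_ t0t)[hdd hdd1 hdd2]; have tp := pos t0t.
have D1 := is_derive_mul (is_derive_powR q tp) hdd1.
have D2 := is_derive_scale alpha (dh t0t).
have D3 := is_derive_opp (is_derive_scale q (is_derive_mul (is_derive_powR (q - 1) tp) (dh t0t))).
exists (q * t `^ (q - 1) * hd t + t `^ q * hdd + alpha * hd t +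
  - (q * ((q - 1) * t `^ (q - 1 - 1) * h t + t `^ (q - 1) * hd t))).
  exact: is_derive_add (is_derive_add D1 D2) D3.
rewrite /E powRB; last by rewrite (gt_eqF tp) implybT.
have -> : q - 1 - 1 = q - 2 by ring.
have tq : 0 < t `^ q by exact: powR_gt0.
have tq2 : 0 < t `^ (q - 2) by exact: powR_gt0.
have := ler_wpM2l (ltW tq) hdd2.
have -> : t `^ q * (hdd + alpha / t `^ q * hd t) = t `^ q * hdd + alpha * hd t.
  by field; rewrite gt_eqF.
have : q * (1 - q) * t `^ (q - 2) * h t <= q * (1 - q) * t `^ (q - 2) * H.
  by rewrite ler_wpM2l ?h_le// mulr_ge0 ?(ltW tq2)// mulr_ge0 ?(ltW q0)// subr_ge0 ltW.
by lra.
Qed.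

(** [G] is a corrector compensating [E]. One choice yields the bound on L, a second one, once L is
    bounded, the limit of [P]. *)
Let P_add_nincr (T1 : R) (G dG : R -> R) : t0 <= T1 ->
  (forall T, t0 <= T -> dominated v t0 T G) ->
  (forall t, T1 <= t -> is_derive t 1 G (dG t)) ->
  (forall t, T1 <= t -> E t + dG t <= 0) ->
  forall s t, T1 <= s -> s <= t -> P t + G t <= P s + G s.
Proof.
move=> T1t0 domG dG_ EG; apply: (@dominated_nincr _ _ v t0 T1 (fun t => P t + G t)) => //.
  move=> T t0T; apply: dominated_add; last exact: domG.
  have dpow r : dominated v t0 T (fun t => t `^ r) by exact: dominated_powR.
  apply: dominated_add.
    apply: dominated_add; first by apply: dominated_mul => //; exact: dom_hd.
    by apply: dominated_scale => //; exact: dom_h.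
  have -> : (fun t => - (q * (t `^ (q - 1) * h t))) = (fun t => - q * (t `^ (q - 1) * h t)).
    by apply/funext => t; rewrite mulNr.
  by apply: dominated_scale => //; apply: dominated_mul => //; exact: dom_h.
apply: filterS dP; first exact: (ae_filter_ringOfSetsType (@lebesgue_measure R)).
move=> t Ht T1t; have [l l1 l2] := Ht (le_trans T1t0 T1t).
exists (l + dG t); first by apply: is_derive_add => //; exact: dG_.
by have := EG t T1t; lra.
Qed.

(* otherwise h t + t^(1-q) / (1-q) would be eventually nonincreasing *)
Let frequently (T : R) : exists t, [/\ T <= t, t0 <= t & - 1 <= t `^ q * hd t].
Proof.
apply: contrapT => nex.
pose T' := Order.max T t0.
have T't0 : t0 <= T' by rewrite le_max lexx orbT.
have T'T : T <= T' by rewrite le_max lexx.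
have lt t : T' <= t -> t `^ q * hd t <= - 1.
  move=> T't; rewrite leNgt; apply/negP => lt; apply: nex; exists t; split; last exact: ltW.
    exact: le_trans T't.
  exact: le_trans T't.
have q1' : 0 < 1 - q by rewrite subr_gt0.
have mono t : T' <= t -> h t + (1 - q)^-1 * t `^ (1 - q) <= h T' + (1 - q)^-1 * T' `^ (1 - q).
  apply: (@derive_le0_nincr R (fun t => h t + (1 - q)^-1 * t `^ (1 - q))
    (fun t => hd t + (1 - q)^-1 * ((1 - q) * t `^ (1 - q - 1))) T') => // s T's;
    have t0s := le_trans T't0 T's; have sp := pos t0s.
    apply: is_derive_add; first exact: dh.
    by apply: is_derive_scale; exact: is_derive_powR.
  rewrite mulrA mulVf ?gt_eqF// mul1r; have -> : 1 - q - 1 = - q by ring.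
  have sq : 0 < s `^ q by exact: powR_gt0.
  rewrite powRN -(pmulr_rle0 _ sq) mulrDr divff ?gt_eqF//; have := lt s T's; lra.
have [T2 _ T2P] := @powR_unbounded R (1 - q) ((1 - q) * (h T' + (1 - q)^-1 * T' `^ (1 - q) + 1)) q1'.
pose t := Order.max T' T2.
have T't : T' <= t by rewrite le_max lexx.
have := T2P t; rewrite le_max lexx orbT => /(_ isT).
rewrite mulrC -ler_pdivlMr// => H1.
have := mono t T't; have := h_ge0 (le_trans T't0 T't).
by move: H1; rewrite mulrC; lra.
Qed.

Let L_ndecr s t : t0 <= s -> s <= t -> L s <= L t.
Proof.
move=> t0s st; rewrite -lerN2.
apply: (@derive_le0_nincr R (fun t => - L t) (fun t => - (t `^ q * e t)) t0) => // u t0u.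
  by apply: is_derive_opp; exact: dL.
by rewrite oppr_le0 mulr_ge0 ?powR_ge0// e_ge0.
Qed.

Let H_ge0 : 0 <= H.
Proof. exact: le_trans (h_ge0 (lexx t0)) (h_le (lexx t0)). Qed.

(** h' has no a priori lower bound, but [frequently] supplies arbitrarily late times where this
    hypothesis holds, and along a nonincreasing P + G a lower bound at such times extends to all
    times. *)
Let P_ge t : t0 <= t -> - 1 <= t `^ q * hd t -> - 1 - q * (t0 `^ (q - 1) * H) <= P t.
Proof.
move=> t0t lt; have := h_ge0 t0t => ht.
have : q * (t `^ (q - 1) * h t) <= q * (t0 `^ (q - 1) * H).
  rewrite ler_wpM2l ?(ltW q0)//; apply: ler_pM => //; rewrite ?powR_ge0 ?h_le//.
  by apply: powR_nincr => //; rewrite subr_le0 ltW.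
by have : 0 <= alpha * h t by [rewrite mulr_ge0// ltW]; rewrite /P; lra.
Qed.

(* P + (2 / alpha) t^(2q) k + L / 2 + C / (p - q - 1) t^(q-p+1) + q H t^(q-1) is eventually nonincreasing:
   the k-terms of its derivative add up to t^q k (4 q / alpha t^(q-1) - 1), and q < 1. *)
Lemma Lyapunov_bounded : exists B : R, forall t, t0 <= t -> L t <= B.
Proof.
have q1' : 0 < 1 - q by rewrite subr_gt0.
have pq : 0 < p - q - 1 by move: qp; lra.
have [T2 T20 T2P] := @powR_unbounded R (1 - q) (4 * q / alpha) q1'.
pose T1 := Order.max t0 T2.
have T1t0 : t0 <= T1 by rewrite le_max lexx.
(* The factor 2 / alpha produces - 2 t^q e, which cancels 3/2 t^q e from [E] and 1/2 t^q e from L /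
   2; the two powers are minus the antiderivatives of the last two terms of [E]. *)
pose G (t : R) := 2 / alpha * (t `^ (2 * q) * k t) + 2^-1 * L t
  + C / (p - q - 1) * t `^ (q - p + 1) + q * H * t `^ (q - 1).
pose dG (t : R) := 2 / alpha * (2 * q * t `^ (2 * q - 1) * k t + t `^ (2 * q) * - (alpha / t `^ q * e t))
  + 2^-1 * (t `^ q * e t)
  + C / (p - q - 1) * ((q - p + 1) * t `^ (q - p + 1 - 1)) + q * H * ((q - 1) * t `^ (q - 1 - 1)).
have mono : forall s t, T1 <= s -> s <= t -> P t + G t <= P s + G s.
  apply: (@P_add_nincr T1 G dG T1t0).
  - move=> T t0T; have dpow r : dominated v t0 T (fun t => t `^ r) by exact: dominated_powR.
    by do 3?apply: dominated_add; apply: dominated_scale => //;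
      do ?[exact: dom_L|apply: dominated_mul => //; exact: dom_k].
  - move=> t T1t; have t0t := le_trans T1t0 T1t; have tp := pos t0t.
    do 3?apply: is_derive_add; apply: is_derive_scale; do ?[exact: is_derive_powR|exact: dL].
    by apply: is_derive_mul; [exact: is_derive_powR|exact: dk].
  move=> t T1t; have t0t := le_trans T1t0 T1t; have tp := pos t0t.
  have tq : 0 < t `^ q by exact: powR_gt0.
  have t2q : t `^ (2 * q) = t `^ q * t `^ q.
    by rewrite -powRD ?(gt_eqF tp) ?implybT//; congr powR; ring.
  have t2q1 : t `^ (2 * q - 1) = t `^ q * t `^ (q - 1).
    by rewrite -powRD ?(gt_eqF tp) ?implybT//; congr powR; ring.
  have small : 4 * q / alpha * t `^ (q - 1) <= 1.
    have -> : q - 1 = - (1 - q) by ring.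
    rewrite powRN ler_pdivrMr ?powR_gt0// mul1r; apply: T2P.
    by apply: le_trans T1t; rewrite le_max lexx orbT.
  rewrite /E /dG t2q t2q1.
  have -> : q - 1 - 1 = q - 2 by ring.
  have -> : q - p + 1 - 1 = q - p by ring.
  have -> : 3 / 2 * (t `^ q * e t) - t `^ q * k t + C * t `^ (q - p) +
    q * (1 - q) * H * t `^ (q - 2) +
    (2 / alpha * (2 * q * (t `^ q * t `^ (q - 1)) * k t +
      t `^ q * t `^ q * - (alpha / t `^ q * e t)) + 2^-1 * (t `^ q * e t) +
     C / (p - q - 1) * ((q - p + 1) * t `^ (q - p)) + q * H * ((q - 1) * t `^ (q - 2))) =
    t `^ q * k t * (4 * q / alpha * t `^ (q - 1) - 1).
    by field; rewrite !gt_eqF.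
  by apply: mulr_ge0_le0; [rewrite mulr_ge0 ?(ltW tq)// k_ge0|lra].
(* At a good time s >= t, L t / 2 <= L s / 2 <= G s <= P T1 + G T1 - P s. *)
exists (2 * (P T1 + G T1 + 1 + q * (t0 `^ (q - 1) * H))) => t t0t.
have [s [ts t0s lts]] := frequently (Order.max t T1).
move: ts; rewrite ge_max => /andP[ts T1s].
have := mono _ _ (lexx _) T1s; have := P_ge t0s lts; have := L_ndecr t0t ts.
have : 2^-1 * L s <= G s.
  have G1 : 0 <= 2 / alpha * (s `^ (2 * q) * k s).
    by rewrite mulr_ge0 ?divr_ge0 ?(ltW al0)// mulr_ge0 ?powR_ge0// k_ge0.
  have G3 : 0 <= C / (p - q - 1) * s `^ (q - p + 1).
    by rewrite mulr_ge0 ?powR_ge0// divr_ge0// ltW.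
  have G4 : 0 <= q * H * s `^ (q - 1).
    by rewrite mulr_ge0 ?powR_ge0// mulr_ge0// ltW.
  by rewrite /G; lra.
by move: (P s) (G s) (P T1) (G T1) => *; lra.
Qed.

(** With L bounded, - 3/2 L may replace the k-term as corrector. Then P + G, L and the powers of t
    all have limits, hence so does t^q h' + alpha h, and the damping lemma passes to h. *)
Lemma Lyapunov_cvg : exists l : R, h t @[t --> +oo] --> l.
Proof.
have pq : 0 < p - q - 1 by move: qp; lra.
have [B LB] := Lyapunov_bounded.
pose G (t : R) := - (3 / 2) * L t
  + C / (p - q - 1) * t `^ (q - p + 1) + q * H * t `^ (q - 1).
pose dG (t : R) := - (3 / 2) * (t `^ q * e t)
  + C / (p - q - 1) * ((q - p + 1) * t `^ (q - p + 1 - 1)) + q * H * ((q - 1) * t `^ (q - 1 - 1)).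
have mono : forall s t, t0 <= s -> s <= t -> P t + G t <= P s + G s.
  apply: (@P_add_nincr t0 G dG (lexx t0)).
  - move=> T t0T; have dpow r : dominated v t0 T (fun t => t `^ r) by exact: dominated_powR.
    by do 2?apply: dominated_add; apply: dominated_scale => //; exact: dom_L.
  - move=> t t0t; have tp := pos t0t.
    by do 2?apply: is_derive_add; apply: is_derive_scale; do ?[exact: is_derive_powR|exact: dL].
  move=> t t0t; have tp := pos t0t.
  have tq : 0 < t `^ q by exact: powR_gt0.
  rewrite /E /dG.
  have -> : q - 1 - 1 = q - 2 by ring.
  have -> : q - p + 1 - 1 = q - p by ring.
  have -> : 3 / 2 * (t `^ q * e t) - t `^ q * k t + C * t `^ (q - p) +
    q * (1 - q) * H * t `^ (q - 2) + (- (3 / 2) * (t `^ q * e t) +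
     C / (p - q - 1) * ((q - p + 1) * t `^ (q - p)) + q * H * ((q - 1) * t `^ (q - 2))) =
    - (t `^ q * k t).
    by field; rewrite !gt_eqF.
  by rewrite oppr_le0 mulr_ge0 ?(ltW tq)// k_ge0.
have [|l1 Pl _] := @nincr_cvg R (fun t => P t + G t) t0
    (- 1 - q * (t0 `^ (q - 1) * H) - 3 / 2 * B) mono.
  move=> t t0t; have [s [ts t0s lts]] := frequently t.
  apply: le_trans (mono _ _ t0t ts); have := P_ge t0s lts.
  have G3 : 0 <= C / (p - q - 1) * s `^ (q - p + 1).
    by rewrite mulr_ge0 ?powR_ge0// divr_ge0// ltW.
  have G4 : 0 <= q * H * s `^ (q - 1).
    by rewrite mulr_ge0 ?powR_ge0// mulr_ge0// ltW.
  by have := LB s t0s; rewrite /G; move: (P s) => *; lra.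
have [l2 Ll _] := ndecr_cvg L_ndecr LB.
have c1 : t `^ (q - p + 1) @[t --> +oo] --> (0 : R) by apply: powRN_cvg0; move: qp q1; lra.
have c2 : t `^ (q - 1) @[t --> +oo] --> (0 : R) by apply: powRN_cvg0; move: qp q1; lra.
have c3 : t `^ (q - 1) * h t @[t --> +oo] --> (0 : R).
  apply/cvgr_pinftyP => d d0.
  have H1 : 0 < H + 1 by have := H_ge0; lra.
  have [T TP] := (cvgr_pinftyP _ _).1 c2 (d / (H + 1)) (divr_gt0 d0 H1).
  exists (Order.max T t0) => t; rewrite ge_max => /andP[/TP + t0t].
  rewrite !subr0 ler_pdivlMr// normrM => H2; apply: le_trans H2.
  by rewrite ler_wpM2l// ger0_norm ?h_ge0//; have := h_le t0t; lra.
exists ((l1 + 3 / 2 * l2 - C / (p - q - 1) * 0 - q * H * 0 + q * 0) / alpha).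
apply: (@cvg_of_damped _ t0 alpha q _ h hd) => //.
have -> : (fun t => t `^ q * hd t + alpha * h t) = (fun t => (P t + G t) + 3 / 2 * L t
   - C / (p - q - 1) * t `^ (q - p + 1) - q * H * t `^ (q - 1) + q * (t `^ (q - 1) * h t)).
  by apply/funext => t; rewrite /P /G; ring.
apply: cvgD; last exact: cvgMr.
apply: cvgB; last exact: cvgMr.
apply: cvgB; last exact: cvgMr.
apply: cvgD => //; exact: cvgMr.
Qed.

End Lyapunov.

(** * Gradients of convex functions, projection onto a shifted convex hull, vector-valued
    increments *)

Section GradientAndProjection.
Context {R : realType} {V : normedModType R} {inner : V -> V -> R}.
Hypothesis Hin : is_inner inner.
Local Notation "⟨ u , v ⟩" := (inner u v).

(** Convexity at parameter s on the segment from x to y, divided by s, with s so small that the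
    remainder of the gradient expansion is at most s e. *)
Lemma convex_gradient_le (f : V -> R) (g : V -> V) : convex_fun f -> is_gradient inner f g ->
  forall x y, f x + ⟨g x, y - x⟩ <= f y.
Proof.
move=> cf gf x y; apply/ler_addgt0Pr => e e0.
have n0 : 0 < `|y - x| + 1 by rewrite ltr_wpDl.
have [d d0 dP] := gf x (e / (`|y - x| + 1)) (divr_gt0 e0 n0).
pose s := Order.min 1 (d / 2 / (`|y - x| + 1)).
have s0 : 0 < s by rewrite lt_min ltr01 !divr_gt0.
have s1 : s <= 1 by rewrite ge_min lexx.
have sd : s * (`|y - x| + 1) <= d / 2 by rewrite -ler_pdivlMr// ge_min lexx orbT.
have hs : `|s *: (y - x)| < d by rewrite normrZ gtr0_norm//; lra.
have := dP _ hs; rewrite normrZ gtr0_norm// (innerZr Hin) ler_norml => /andP[+ _].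
have E1 : x + s *: (y - x) = s *: y + (1 - s) *: x.
  by rewrite scalerBr scalerBl scale1r addrC addrA addrAC -addrA.
rewrite E1; have := cf y x s; rewrite (ltW s0) s1 => /(_ isT) H1 H2.
have H3 : e / (`|y - x| + 1) * (s * `|y - x|) <= s * e.
  rewrite mulrCA ler_pM2l// mulrAC ler_pdivrMr// ler_pM2l//; lra.
have : s * (f x + ⟨g x, y - x⟩) <= s * (f y + e) by lra.
by rewrite ler_pM2l.
Qed.

Lemma is_derive_gradient (f : V -> R) (g : V -> V) (x : R -> V) (dx : V) (t : R) :
  is_gradient inner f g -> is_derive (t : R^o) (1 : R^o) x dx ->
  is_derive t 1 (fun s => f (x s)) ⟨g (x t), dx⟩.
Proof.
move=> gf /is_deriveP xP; apply/is_deriveP => e e0.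
have [n0 n1] : 0 < `|dx| + 1 /\ 0 < `|g (x t)| + 1 by rewrite !ltr_wpDl.
have [d1 d10 d1P] := gf (x t) (e / 2 / (`|dx| + 1)) (divr_gt0 (divr_gt0 e0 (ltr0Sn _ 1)) n0).
pose eta := Order.min 1 (e / 2 / (`|g (x t)| + 1)).
have eta0 : 0 < eta by rewrite lt_min ltr01 !divr_gt0.
have eta1 : eta <= 1 by rewrite ge_min lexx.
have etag : eta * (`|g (x t)| + 1) <= e / 2 by rewrite -ler_pdivlMr// ge_min lexx orbT.
have [d2 d20 d2P] := xP _ eta0.
exists (Order.min d2 (d1 / (`|dx| + 1))); first by rewrite lt_min d20 divr_gt0.
move=> h; rewrite lt_min => /andP[hd2 hd1].
pose k := x (t + h) - x t.
have xk : x (t + h) = x t + k by rewrite /k subrKC.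
have H2 := d2P h hd2; rewrite -/k in H2.
have kb : `|k| <= `|h| * (`|dx| + 1).
  have -> : k = (k - h *: dx) + h *: dx by rewrite subrK.
  apply: (le_trans (ler_normD _ _)); rewrite normrZ.
  have : eta * `|h| <= `|h| by rewrite -[leRHS]mul1r ler_wpM2r.
  lra.
have kd : `|k| < d1 by apply: (le_lt_trans kb); rewrite -ltr_pdivlMr.
have H1 := d1P k kd; rewrite xk.
have -> : f (x t + k) - f (x t) - h *: ⟨g (x t), dx⟩ =
   (f (x t + k) - f (x t) - ⟨g (x t), k⟩) + ⟨g (x t), k - h *: dx⟩.
  by rewrite (innerBr Hin _ k (h *: dx)) (innerZr Hin) /GRing.scale /=; ring.
apply: (le_trans (ler_normD _ _)).
have H3 : `|⟨g (x t), k - h *: dx⟩| <= e / 2 * `|h|.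
  apply: (le_trans (norm_inner Hin _ _)).
  apply: (le_trans (ler_wpM2l (normr_ge0 _) H2)).
  rewrite mulrA ler_wpM2r//; move: etag; rewrite mulrDr mulr1 mulrC; lra.
have H4 : e / 2 / (`|dx| + 1) * `|k| <= e / 2 * `|h|.
  rewrite mulrAC ler_pdivrMr//.
  by apply: (le_trans (ler_wpM2l (_ : 0 <= e / 2) kb)); [rewrite divr_ge0 ?ltW|rewrite mulrA].
lra.
Qed.

(** Minimality of the norm of z is tested against z + s (g_i - c), which stays in the set for s in
    ]0, 1]; the first-order term in s must be nonnegative. *)
Lemma proj_convhull_variational (m : nat) (g : 'I_m -> V -> V) (y w z : V) :
  is_proj [set u | exists2 c, convhull g y c & u = c + w] 0 z ->
  exists2 c, convhull g y c & z = c + w /\ forall i, 0 <= ⟨z, g i y - c⟩.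
Proof.
move=> [[c cg zc] zmin]; exists c => //; split=> // i.
have [lam [lam0 [lam1 cE]]] := cg.
pose d := g i y - c.
have key (s : R) : 0 < s <= 1 -> 0 <= 2 * ⟨z, d⟩ + s * `|d| ^+ 2.
  move=> /andP[s0 s1].
  have := zmin (z + s *: d); rewrite !sub0r !normrN => /(_ _)/(le_trans _) H.
  have {H} : `|z| <= `|z + s *: d|.
    apply: H => //; exists (c + s *: d); last by rewrite zc addrAC.
    exists (fun j => (1 - s) * lam j + s * (j == i)%:R); split; [|split].
    - by move=> j; rewrite addr_ge0// mulr_ge0// ?subr_ge0// ltW.
    - rewrite big_split /= -mulr_sumr lam1 -mulr_sumr (bigD1 i)//= eqxx big1.
        by rewrite /=; ring.
      by move=> j /negPf ->.
    under eq_bigr do rewrite scalerDl -!scalerA.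
    rewrite big_split /= -!scaler_sumr -cE (bigD1 i)//= eqxx scale1r big1; last first.
      by move=> j /negPf ->; rewrite scale0r.
    by rewrite addr0 /d scalerBr scalerBl scale1r addrA addrAC.
  rewrite -(ler_pXn2r (n := 2)) ?nnegrE ?normr_ge0// (sqr_normD Hin) (innerZr Hin) normrZ exprMn.
  rewrite (ger0_norm (ltW s0)) -addrA lerDl.
  have -> : 2 * (s * ⟨z, d⟩) + s ^+ 2 * `|d| ^+ 2 = s * (2 * ⟨z, d⟩ + s * `|d| ^+ 2) by ring.
  by rewrite pmulr_rge0.
have n0 : 0 < `|d| ^+ 2 + 1 by rewrite ltr_wpDl// exprn_ge0.
rewrite leNgt; apply/negP => A0.
(* With this s, 2 ⟨z, d⟩ + s |d|^2 <= ⟨z, d⟩ - s < 0, contradicting [key]. *)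
pose s := Order.min 1 (- ⟨z, d⟩ / (`|d| ^+ 2 + 1)).
have s0 : 0 < s by rewrite lt_min ltr01 divr_gt0// oppr_gt0.
have sd : s * (`|d| ^+ 2 + 1) <= - ⟨z, d⟩ by rewrite -ler_pdivlMr// ge_min lexx orbT.
have := key s; rewrite s0 ge_min lexx => /(_ isT); rewrite -/d in A0; lra.
Qed.

(** Pairing with the fixed vector x w - x u reduces the claim to the scalar mean value theorem. *)
Lemma vector_mean_value (x xd : R -> V) (B u w : R) :
  (forall t : R, is_derive (t : R^o) (1 : R^o) x (xd t)) -> u <= w ->
  (forall t, u <= t <= w -> `|xd t| <= B) -> `|x w - x u| <= B * (w - u).
Proof.
move=> dx uw xdB; set y := x w - x u.
have [->|y0] := eqVneq y 0.
  by rewrite normr0 mulr_ge0 ?subr_ge0//; apply: le_trans (xdB u _); rewrite ?lexx ?uw.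
have [c cI] := @mean_value R (fun t => ⟨x t, y⟩) (fun t => ⟨xd t, y⟩) u w uw
  (fun t _ => is_derive_eq (is_derive_inner Hin (dx t) (is_derive_cst y _ _))
     (etrans (congr1 _ (inner0r Hin _)) (addr0 _))).
rewrite -(innerBl Hin) -/y (inner_norm Hin) => E.
have : `|y| ^+ 2 <= `|y| * (B * (w - u)).
  rewrite E; have := inner_le Hin (xd c) y => H.
  have H1 : ⟨xd c, y⟩ <= B * `|y| by apply: (le_trans H); rewrite ler_wpM2r// xdB.
  apply: (le_trans (ler_wpM2r _ H1)); first by rewrite subr_ge0.
  by rewrite mulrCA -mulrA.
by rewrite expr2 ler_pM2l ?normr_gt0.
Qed.

Lemma dominated_inner (v : R -> V) (a b : R) (u1 u2 : R -> V) (C1 C2 B1 B2 : R) :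
  0 <= C1 -> 0 <= C2 -> 0 <= B1 -> 0 <= B2 ->
  (forall u w, a <= u -> u <= w -> w <= b -> `|u1 w - u1 u| <= C1 * (w - u + `|v w - v u|)) ->
  (forall u w, a <= u -> u <= w -> w <= b -> `|u2 w - u2 u| <= C2 * (w - u + `|v w - v u|)) ->
  (forall t, a <= t <= b -> `|u1 t| <= B1) -> (forall t, a <= t <= b -> `|u2 t| <= B2) ->
  dominated v a b (fun t => ⟨u1 t, u2 t⟩).
Proof.
move=> C10 C20 B10 B20 H1 H2 H3 H4; exists (C1 * B2 + B1 * C2).
  by rewrite addr_ge0// mulr_ge0.
move=> u w au uw wb.
have -> : ⟨u1 w, u2 w⟩ - ⟨u1 u, u2 u⟩ = ⟨u1 w - u1 u, u2 w⟩ + ⟨u1 u, u2 w - u2 u⟩.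
  by rewrite (innerBl Hin) (innerBr Hin); ring.
apply: (le_trans (ler_normD _ _)).
apply: (le_trans (lerD (norm_inner Hin _ _) (norm_inner Hin _ _))).
have K1 := H1 u w au uw wb; have K2 := H2 u w au uw wb.
have K3 : `|u2 w| <= B2 by apply: H4; apply/andP; split; lra.
have K4 : `|u1 u| <= B1 by apply: H3; apply/andP; split; lra.
have := ler_pM (normr_ge0 _) (normr_ge0 _) K1 K3.
have := ler_pM (normr_ge0 _) (normr_ge0 _) K4 K2.
lra.
Qed.

End GradientAndProjection.

(** * The trajectory: equation of motion, energies and their dissipation *)

Section Trajectory.
Context {R : realType} {V : completeNormedModType R} {inner : V -> V -> R} {m : nat}.
Context (f : 'I_m -> V -> R) (g : 'I_m -> V -> V) (t0 alpha beta q p M : R) (x xd xdd : R -> V).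
Local Notation "⟨ u , v ⟩" := (inner u v).
Local Notation mu := (@lebesgue_measure R).

Hypothesis Hin : is_inner inner.
Hypothesis f_convex : forall i, convex_fun (f i).
Hypothesis f_gradient : forall i, is_gradient inner (f i) (g i).
Hypothesis g_lipschitz : forall i, lipschitz_map (g i).
Hypotheses (t00 : 0 < t0) (al0 : 0 < alpha) (be0 : 0 < beta).
Hypotheses (q0 : 0 < q) (q1 : q < 1) (qp : q + 1 < p).
Hypothesis x_derive : forall t : R, is_derive (t : R^o) (1 : R^o) x (xd t).
Hypothesis xd_continuous : continuous xd.
Hypothesis xd_ac : forall T, t0 <= T -> abs_cont_on xd t0 T.
Hypothesis xd_derive :
  {ae mu, forall t : R, t0 <= t -> is_derive (t : R^o) (1 : R^o) xd (xdd t)}.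
Hypothesis x_proj : {ae mu, forall t, t0 <= t ->
  is_proj [set y | exists2 c, convhull g (x t) c & y = c + (beta / t `^ p) *: x t + xdd t]
    0 (- ((alpha / t `^ q) *: xd t))}.
Hypothesis x_bounded : forall t, t0 <= t -> `|x t| <= M.
Hypothesis i0 : 'I_m.

Let ae_filter := ae_filter_ringOfSetsType (@lebesgue_measure R).

Let pos t : t0 <= t -> 0 < t. Proof. exact: lt_le_trans. Qed.

Let M_ge0 : 0 <= M. Proof. exact: le_trans (normr_ge0 _) (x_bounded (lexx t0)). Qed.

Let e (t : R) := ⟨xd t, xd t⟩.

Let e_ge0 t : 0 <= e t. Proof. by rewrite /e (inner_norm Hin) exprn_ge0. Qed.

Let x_cont : continuous x. Proof. by move=> t; exact: is_derive_cvg (x_derive t). Qed.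

Let e_cont : continuous e.
Proof. by move=> t; apply: (cvg_inner Hin); exact: xd_continuous. Qed.

Let W (i : 'I_m) (t : R) := f i (x t) + (beta / 2 * (t `^ (- p) * ⟨x t, x t⟩) + 2^-1 * e t).

(** The projection equals - (alpha / t^q) x', so its variational inequality reads ⟨g_i, x'⟩ <= ⟨c,
    x'⟩. One multiplier c thus serves every objective, which is why all energies dissipate
    simultaneously. *)
Let dynamics : {ae mu, forall t : R, t0 <= t -> is_derive (t : R^o) (1 : R^o) xd (xdd t) /\
  exists2 c, convhull g (x t) c &
    [/\ xdd t = - c - (beta / t `^ p) *: x t - (alpha / t `^ q) *: xd t &
        forall i, ⟨g i (x t), xd t⟩ <= ⟨c, xd t⟩]}.
Proof.
apply: filterS2 xd_derive x_proj; first exact: ae_filter.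
move=> t D P t0t; split; first exact: D.
have K : is_proj [set u | exists2 c, convhull g (x t) c &
    u = c + ((beta / t `^ p) *: x t + xdd t)] 0 (- ((alpha / t `^ q) *: xd t)).
  have [[c cg cE] Pm] := P t0t; split; first by exists c; rewrite // cE addrA.
  by move=> w [c' c'g ->]; apply: Pm; exists c'; rewrite // addrA.
have [c cg [cE ci]] := proj_convhull_variational Hin K.
exists c => //; split.
  by rewrite cE -opprD (addrA c) addKr.
move=> i; have := ci i; rewrite (innerNl Hin) (innerZl Hin) (innerBr Hin) oppr_ge0.
rewrite pmulr_rle0; last by rewrite divr_gt0// powR_gt0// pos.
by rewrite subr_le0 !(innerC Hin (xd t)).
Qed.

Let energy_slope t i (c : V) : t0 <= t ->
  xdd t = - c - (beta / t `^ p) *: x t - (alpha / t `^ q) *: xd t ->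
  ⟨g i (x t), xd t⟩ <= ⟨c, xd t⟩ ->
  ⟨g i (x t), xd t⟩ + beta / t `^ p * ⟨x t, xd t⟩ + ⟨xdd t, xd t⟩ <= - (alpha / t `^ q * e t).
Proof.
move=> t0t -> gc; rewrite !(innerBl Hin) (innerNl Hin) !(innerZl Hin) -/(e t); lra.
Qed.

(** The left side is h'' + alpha t^(-q) h' for h = |x - z|^2 / 2. Convexity, averaged with the
    weights of c, gives d <= ⟨c, x - z⟩, and 2 ⟨x, z⟩ <= |x|^2 + |z|^2 handles the Tikhonov term.
    The term - |x|^2 is kept to cancel the one inside the energy; d is free since it is used with a
    time-dependent and with a constant gap. *)
Let anchor_slope t (c z : V) (d : R) : t0 <= t -> convhull g (x t) c ->
  xdd t = - c - (beta / t `^ p) *: x t - (alpha / t `^ q) *: xd t ->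
  (forall i, d <= f i (x t) - f i z) ->
  e t + ⟨x t - z, xdd t⟩ + alpha / t `^ q * ⟨x t - z, xd t⟩ <=
    e t + beta / 2 / t `^ p * (`|z| ^+ 2 - ⟨x t, x t⟩) - d.
Proof.
move=> t0t [lam [lam0 [lam1 cE]]] -> df.
have H : d <= ⟨c, x t - z⟩.
  rewrite cE (inner_suml Hin) -[leLHS]mul1r -lam1 mulr_suml; apply: ler_sum => i _.
  rewrite (innerZl Hin) ler_wpM2l//; apply: (le_trans (df i)).
  have := convex_gradient_le Hin (f_convex i) (f_gradient i) (x t) z.
  by rewrite !(innerBr Hin); lra.
rewrite !(innerBr Hin) (innerNr Hin) !(innerZr Hin).
have tp : 0 < beta / t `^ p by rewrite divr_gt0// powR_gt0// pos.
have sq : beta / t `^ p * (2 * ⟨x t, z⟩) <= beta / t `^ p * (⟨x t, x t⟩ + `|z| ^+ 2).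
  rewrite ler_pM2l//; have := sqr_ge0 (`|x t - z|); rewrite (sqr_normB Hin) -(inner_norm Hin (x t)).
  lra.
have -> : beta / 2 / t `^ p = beta / t `^ p / 2 by field; rewrite gt_eqF// powR_gt0// pos.
move: H; rewrite (innerC Hin c) !(innerBl Hin) !(innerC Hin z (x t)); lra.
Qed.

Let xd_loc_bounded T : exists2 B : R, 0 <= B & forall t, t0 <= t <= T -> `|xd t| <= B.
Proof.
have [|B B0 BP] := @continuous_bounded R (fun t => `|xd t|) t0 T.
  by move=> t _; apply: cvg_norm; exact: xd_continuous.
by exists B => // t /BP; rewrite normr_id.
Qed.

Let dom_e T : t0 <= T -> dominated xd t0 T e.
Proof.
move=> t0T; have [B B0 BP] := xd_loc_bounded T.
by apply: (@dominated_inner _ _ _ Hin _ _ _ xd xd 1 1 B B) => // u w t0u uw wT;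
  rewrite mul1r lerDr subr_ge0.
Qed.

Let dom_xx T : t0 <= T -> dominated xd t0 T (fun t => ⟨x t, x t⟩).
Proof.
move=> t0T; apply: (@dominated_C1 _ _ _ _ (fun t => ⟨xd t, x t⟩ + ⟨x t, xd t⟩)) => t _.
  exact: is_derive_inner.
by apply: cvgD; apply: (cvg_inner Hin); (exact: x_cont || exact: xd_continuous).
Qed.

Let g_cont i : continuous (g i).
Proof.
have [L HL] := g_lipschitz i; move=> y; apply/cvgrPdist_le => d d0.
have n0 : 0 < `|L| + 1 by rewrite ltr_wpDl.
near=> z; apply: (le_trans (HL y z)).
apply: (@le_trans _ _ ((`|L| + 1) * `|y - z|)).
  by rewrite ler_wpM2r//; have := ler_norm L; lra.
rewrite mulrC -ler_pdivlMr//; near: z.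
by apply: cvgr_dist_le; [exact: cvg_id|rewrite divr_gt0].
Unshelve. all: by end_near. Qed.

Let fx_derive i (t : R) : is_derive t 1 (fun s => f i (x s)) ⟨g i (x t), xd t⟩.
Proof. exact: (is_derive_gradient Hin (f_gradient i) (x_derive t)). Qed.

Let dom_fx i T : t0 <= T -> dominated xd t0 T (fun t => f i (x t)).
Proof.
move=> t0T; apply: (@dominated_C1 _ _ _ _ (fun t => ⟨g i (x t), xd t⟩)) => t _.
  exact: fx_derive.
apply: (cvg_inner Hin); last exact: xd_continuous.
by apply: (@cvg_comp _ _ _ x (g i)); [exact: x_cont|exact: g_cont].
Qed.

Let dom_W i T : t0 <= T -> dominated xd t0 T (W i).
Proof.
move=> t0T; apply: dominated_add; first exact: dom_fx.
apply: dominated_add; apply: dominated_scale => //; last exact: dom_e.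
by apply: dominated_mul => //; [exact: dominated_powR|exact: dom_xx].
Qed.

Let powR_cont (r t : R) : 0 < t -> {for t, continuous (fun s : R => s `^ r)}.
Proof. by move=> tp; exact: is_derive_continuous (is_derive_powR r tp). Qed.

Let K_exists : exists K : R -> R, forall t, t0 <= t ->
  is_derive t 1 K (alpha / t `^ q * e t).
Proof.
have [|K KP] := @exists_antiderivative R (fun t => alpha * t `^ (- q) * e t) (t0 / 2).
  move=> t tt; have tp : 0 < t by move: t00 tt; lra.
  apply: cvgM; last exact: e_cont.
  by apply: cvgMr; exact: powR_cont.
exists K => t t0t; rewrite -powRN; apply: KP; move: t00 t0t; lra.
Qed.

Let L_exists : exists L : R -> R, forall t, t0 <= t -> is_derive t 1 L (t `^ q * e t).
Proof.
have [|L LP] := @exists_antiderivative R (fun t => t `^ q * e t) (t0 / 2).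
  move=> t tt; have tp : 0 < t by move: t00 tt; lra.
  by apply: cvgM; [exact: powR_cont|exact: e_cont].
by exists L => t t0t; apply: LP; move: t00 t0t; lra.
Qed.

Let dom_antiderivative (r c : R) (K : R -> R) T :
  (forall t, t0 <= t -> is_derive t 1 K (c * t `^ r * e t)) -> dominated xd t0 T K.
Proof.
move=> KP; apply: (@dominated_C1 _ _ _ _ (fun t => c * t `^ r * e t)) => t /andP[t0t _].
  exact: KP.
by apply: cvgM; [apply: cvgMr; apply: powR_cont; exact: pos|exact: e_cont].
Qed.

(** The derivative of K offsets the dissipation; monotonicity of the sum, rather than of W alone,
    lets W minus its limit dominate the remaining integral. *)
Let W_K_nincr (K : R -> R) i : (forall t, t0 <= t -> is_derive t 1 K (alpha / t `^ q * e t)) ->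
  forall s t, t0 <= s -> s <= t -> W i t + K t <= W i s + K s.
Proof.
move=> KP; apply: (@dominated_nincr _ _ xd t0 t0 (fun t => W i t + K t)) => //.
  move=> T t0T; apply: dominated_add; first exact: dom_W.
  by apply: (@dom_antiderivative (- q) alpha) => t /KP; rewrite powRN.
apply: filterS dynamics; first exact: ae_filter.
move=> t /[swap] t0t /(_ t0t)[D [c cg [cE ci]]].
have tp := pos t0t.
have De : is_derive t 1 e (⟨xdd t, xd t⟩ + ⟨xd t, xdd t⟩) by exact: is_derive_inner.
have Dx : is_derive t 1 (fun s => ⟨x s, x s⟩) (⟨xd t, x t⟩ + ⟨x t, xd t⟩) by exact: is_derive_inner.
exists (⟨g i (x t), xd t⟩ + (beta / 2 * (- p * t `^ (- p - 1) * ⟨x t, x t⟩ +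
   t `^ (- p) * (⟨xd t, x t⟩ + ⟨x t, xd t⟩)) + 2^-1 * (⟨xdd t, xd t⟩ + ⟨xd t, xdd t⟩))
   + alpha / t `^ q * e t).
  apply: is_derive_add; last exact: KP.
  apply: is_derive_add; first exact: fx_derive.
  apply: is_derive_add; apply: is_derive_scale => //.
  by apply: is_derive_mul => //; exact: is_derive_powR.
have := energy_slope t0t cE (ci i).
rewrite !(innerC Hin (xd t)) powRN.
have : 0 <= beta * (p * t `^ (- p - 1) * ⟨x t, x t⟩).
  rewrite mulr_ge0 ?(ltW be0)// mulr_ge0 ?(inner_norm Hin) ?exprn_ge0// mulr_ge0 ?powR_ge0//.
  by move: q0 qp; lra.
lra.
Qed.

(** The tangent plane at 0 is an affine minorant, bounded below on the bounded trajectory. *)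
Let fx_ge i : exists b : R, forall t, t0 <= t -> b <= f i (x t).
Proof.
exists (f i 0 - `|g i 0| * M) => t t0t.
have := convex_gradient_le Hin (f_convex i) (f_gradient i) 0 (x t); rewrite subr0.
have := norm_inner Hin (g i 0) (x t); rewrite ler_norml => /andP[+ _].
have := ler_wpM2l (normr_ge0 (g i 0)) (x_bounded t0t); lra.
Qed.

Let W_ge i t : t0 <= t -> f i (x t) <= W i t.
Proof.
move=> t0t; rewrite lerDl addr_ge0// mulr_ge0 ?e_ge0//; first by rewrite divr_ge0 ?ltW.
by rewrite mulr_ge0 ?powR_ge0// (inner_norm Hin) exprn_ge0.
Qed.

(* k is the energy still to be dissipated, the integral of alpha / s^q |xd s|^2 over [t, +oo). *)
Lemma energy_limits : exists (finf : 'I_m -> R) (k : R -> R), [/\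
  forall i, W i t @[t --> +oo] --> finf i,
  forall t, t0 <= t -> 0 <= k t,
  forall t, t0 <= t -> is_derive t 1 k (- (alpha / t `^ q * e t)) &
  forall i t, t0 <= t -> k t <= W i t - finf i].
Proof.
have [K KP] := K_exists.
have K_ndecr s t : t0 <= s -> s <= t -> K s <= K t.
  move=> t0s st; rewrite -lerN2.
  apply: (@derive_le0_nincr R (fun t => - K t) (fun t => - (alpha / t `^ q * e t)) t0) => // u t0u.
    by apply: is_derive_opp; exact: KP.
  by rewrite oppr_le0 mulr_ge0 ?e_ge0// divr_ge0 ?powR_ge0// ltW.
have lim i : exists l : R, W i t + K t @[t --> +oo] --> l /\ forall t, t0 <= t -> l <= W i t + K t.
  have [b bP] := fx_ge i.
  have [|l l1 l2] := @nincr_cvg R (fun t => W i t + K t) t0 (b + K t0) (W_K_nincr i KP).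
    by move=> t t0t; apply: lerD; [exact: le_trans (bP t t0t) (W_ge i t0t)|exact: K_ndecr].
  by exists l.
have [l lP] := choice lim.
(* One index suffices: W + K is nonincreasing and W is bounded below, so K is bounded above. *)
have [Kinf Kcvg KKinf] : exists2 l : R, K t @[t --> +oo] --> l & forall t, t0 <= t -> K t <= l.
  have [b bP] := fx_ge i0.
  apply: (@ndecr_cvg R K t0 (W i0 t0 + K t0 - b) K_ndecr) => t t0t.
  have := W_K_nincr i0 KP (lexx t0) t0t; have := W_ge i0 t0t; have := bP t t0t; lra.
exists (fun i => l i - Kinf), (fun t => Kinf - K t); split.
- move=> i; have -> : W i = (fun t => W i t + K t - K t) by apply/funext => t; rewrite addrK.
  by apply: cvgB => //; exact: (lP i).1.
- by move=> t t0t; rewrite subr_ge0 KKinf.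
- move=> t t0t; rewrite -[X in is_derive _ _ _ X]add0r.
  by apply: is_derive_add; apply: is_derive_opp; exact: KP.
- by move=> i t t0t; have := (lP i).2 t t0t; lra.
Qed.

(** * Half the squared distance to an anchor z *)

Section Anchored.
Context (z : V).

Let h (t : R) := 2^-1 * ⟨x t - z, x t - z⟩.
Let hd (t : R) := ⟨x t - z, xd t⟩.

Let xz_derive (t : R) : is_derive (t : R^o) (1 : R^o) (fun s => x s - z) (xd t).
Proof.
apply: is_derive_eq (is_deriveB (x_derive t) (is_derive_cst z _ _)) _.
by rewrite subr0.
Qed.

Lemma anchor_derive (t : R) : is_derive t 1 h (hd t).
Proof.
apply: is_derive_eq (is_derive_scale 2^-1 (is_derive_inner Hin (xz_derive t) (xz_derive t))) _.
by rewrite (innerC Hin (xd t)) /hd; field.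
Qed.

Lemma dominated_anchor_derive T : t0 <= T -> dominated xd t0 T hd.
Proof.
move=> t0T; have [B B0 BP] := xd_loc_bounded T.
apply: (@dominated_inner _ _ _ Hin _ _ _ (fun t => x t - z) xd B 1 (M + `|z|) B) => //.
- by rewrite addr_ge0.
- move=> u w t0u uw wT; have -> : x w - z - (x u - z) = x w - x u by rewrite opprB addrA subrK.
  apply: (@le_trans _ _ (B * (w - u))); last by rewrite ler_wpM2l// lerDl.
  apply: (vector_mean_value Hin x_derive) => // t /andP[ut tw].
  by apply: BP; apply/andP; split; lra.
- by move=> u w t0u uw wT; rewrite mul1r lerDr subr_ge0.
- move=> t /andP[t0t _]; apply: (le_trans (ler_normB _ _)).
  by rewrite lerD2r x_bounded.
Qed.

Lemma dominated_anchor T : t0 <= T -> dominated xd t0 T h.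
Proof.
move=> t0T; apply: (@dominated_C1 _ _ _ _ hd) => t _; first exact: anchor_derive.
apply: (cvg_inner Hin); last exact: xd_continuous.
by apply: cvgB; [exact: x_cont|exact: cvg_cst].
Qed.

Lemma anchor_derive2 (t : R) : is_derive (t : R^o) (1 : R^o) xd (xdd t) ->
  is_derive t 1 hd (e t + ⟨x t - z, xdd t⟩).
Proof. by move=> D; exact: (is_derive_inner Hin (xz_derive t) D). Qed.

Lemma anchor_bounds t : t0 <= t -> 0 <= h t /\ h t <= 2^-1 * (M + `|z|) ^+ 2.
Proof.
move=> t0t; rewrite /h (inner_norm Hin); split; first by rewrite mulr_ge0 ?exprn_ge0.
rewrite ler_pM2l// ler_pXn2r ?nnegrE ?addr_ge0//.
by apply: (le_trans (ler_normB _ _)); rewrite lerD2r x_bounded.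
Qed.

End Anchored.

Lemma anchored_Lyapunov (finf : 'I_m -> R) (k : R -> R) (z : V) :
  (forall t, t0 <= t -> 0 <= k t) ->
  (forall t, t0 <= t -> is_derive t 1 k (- (alpha / t `^ q * e t))) ->
  (forall i t, t0 <= t -> k t <= W i t - finf i) -> (forall i, f i z <= finf i) ->
  (exists l : R, `|x t - z| ^+ 2 @[t --> +oo] --> l) /\
  exists (L : R -> R) (B : R), (forall t, t0 <= t -> is_derive t 1 L (t `^ q * e t)) /\
     (forall t, t0 <= t -> L t <= B).
Proof.
move=> k_ge0 dk kW zf; have [L LP] := L_exists.
have dom_k T : t0 <= T -> dominated xd t0 T k.
  move=> _; apply: (@dom_antiderivative (- q) (- alpha)) => t /dk.
  by rewrite powRN -!mulNr.
have dom_L T : t0 <= T -> dominated xd t0 T L.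
  by move=> _; apply: (@dom_antiderivative q 1) => t /LP; rewrite mul1r.
have C0 : 0 <= beta / 2 * `|z| ^+ 2 by rewrite mulr_ge0 ?exprn_ge0// divr_ge0 ?ltW.
have ode : {ae mu, forall t : R, t0 <= t ->
  exists2 hdd : R, is_derive t 1 (fun t => ⟨x t - z, xd t⟩) hdd &
    hdd + alpha / t `^ q * ⟨x t - z, xd t⟩ <= 3 / 2 * e t - k t + beta / 2 * `|z| ^+ 2 / t `^ p}.
  apply: filterS dynamics; first exact: ae_filter.
move=> t /[swap] t0t /(_ t0t)[D [c cg [cE ci]]].
  exists (e t + ⟨x t - z, xdd t⟩); first exact: anchor_derive2.
  (* This is k minus the non-objective part of W. In [anchor_slope] its |x|^2 term cancels and its e
     / 2 raises the coefficient of e to 3/2. *)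
  pose d := k t - 2^-1 * e t - beta / 2 * (t `^ (- p) * ⟨x t, x t⟩).
  have df i : d <= f i (x t) - f i z.
    by have := kW i t t0t; have := zf i; rewrite /d /W; lra.
  have := anchor_slope t0t cg cE df; rewrite /d powRN; lra.
split; last first.
  exists L.
  have [B BP] := Lyapunov_bounded t00 al0 q0 q1 qp C0 xd_continuous xd_ac
    (dominated_anchor z) (dominated_anchor_derive z) dom_k dom_L
    (fun t _ => anchor_derive z t) dk LP (fun t t0t => (anchor_bounds z t0t).1)
    (fun t t0t => (anchor_bounds z t0t).2) k_ge0 (fun t _ => e_ge0 t) ode.
  by exists B.
have [l lP] := Lyapunov_cvg t00 al0 q0 q1 qp C0 xd_continuous xd_ac
    (dominated_anchor z) (dominated_anchor_derive z) dom_k dom_L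
    (fun t _ => anchor_derive z t) dk LP (fun t t0t => (anchor_bounds z t0t).1)
    (fun t t0t => (anchor_bounds z t0t).2) k_ge0 (fun t _ => e_ge0 t) ode.
exists (2 * l); have -> : (fun t => `|x t - z| ^+ 2) = (fun t => 2 * (2^-1 * ⟨x t - z, x t - z⟩)).
  by apply/funext => t; rewrite (inner_norm Hin) mulrA divff// mul1r.
exact: cvgMr.
Qed.

(** * Weak limit, vanishing velocity, convergence of the values and optimality *)

(** The values f_i(x) are compared with W_i because their own convergence awaits x' -> 0, which in
    turn uses an anchor in this sublevel set. Opial's lemma also shows that the set is nonempty. *)
Lemma weak_cvg_sublevel (finf : 'I_m -> R) (k : R -> R) :
  (forall i, W i t @[t --> +oo] --> finf i) ->
  (forall t, t0 <= t -> 0 <= k t) ->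
  (forall t, t0 <= t -> is_derive t 1 k (- (alpha / t `^ q * e t))) ->
  (forall i t, t0 <= t -> k t <= W i t - finf i) ->
  exists2 xs, (forall i, f i xs <= finf i) & forall y, ⟨x t, y⟩ @[t --> +oo] --> ⟨xs, y⟩.
Proof.
move=> Wf k0 dk kW.
apply: (@opial _ _ _ Hin _ _ x M [set z | forall i, f i z <= finf i]).
- by apply: filterS (near_ge t0) => t; exact: x_bounded.
- by move=> z zf; have [[l lP] _] := anchored_Lyapunov k0 dk kW zf; exact: cvgP lP.
move=> G c UG FG cG i.
have WG : W i t @[t --> G] --> finf i by apply: cvg_trans (Wf i); exact: cvg_app.
have lim : W i t + (⟨c, g i c⟩ - ⟨x t, g i c⟩) @[t --> G] --> finf i + (⟨c, g i c⟩ - ⟨c, g i c⟩).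
  by apply: cvgD => //; apply: cvgB => //; exact: cvg_cst.
rewrite subrr addr0 in lim; apply: (cvg_near_ge lim).
apply: filterS (FG _ (near_ge t0)) => t t0t.
have := convex_gradient_le Hin (f_convex i) (f_gradient i) c (x t).
rewrite (innerBr Hin) !(innerC Hin (g i c)); have := W_ge i t0t; lra.
Qed.

(** The energy inequality for one objective bounds the derivative of |x'|^2 from above, through
    bounds on its gradient, on x and on x'; this is the one-sided growth condition of the Barbalat
    argument. *)
Lemma velocity_cvg0 (l : R) (L : R -> R) (B : R) :
  W i0 t @[t --> +oo] --> l ->
  (forall t, t0 <= t -> is_derive t 1 L (t `^ q * e t)) ->
  (forall t, t0 <= t -> L t <= B) -> e t @[t --> +oo] --> (0 : R).
Proof.
move=> Wl LP LB; have [b bP] := fx_ge i0.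
have be2 : 0 <= beta / 2 by rewrite divr_ge0 ?(ltW be0).
have [T0 T0P] := (cvgr_pinftyP _ _).1 Wl 1 ltr01.
pose T := Order.max T0 t0; have t0T : t0 <= T by rewrite le_max lexx orbT.
(* The added 1 ensures E0 >= 1, so |x'|^2 <= E0 <= E0^2 and E0 bounds |x'| as well. *)
pose E0 := 2 * (`|l + 1 - b| + 1).
have E0_ge1 : 1 <= E0 by rewrite /E0; have := normr_ge0 (l + 1 - b); lra.
have eE t : T <= t -> e t <= E0.
  move=> Tt; have t0t := le_trans t0T Tt.
  have T0t : T0 <= t by apply: le_trans Tt; rewrite le_max lexx.
  have := T0P t T0t; rewrite ler_norml => /andP[_]; have := bP t t0t.
  have : 0 <= beta / 2 * (t `^ (- p) * ⟨x t, x t⟩).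
    by rewrite mulr_ge0// mulr_ge0 ?powR_ge0// (inner_norm Hin) exprn_ge0.
  have := ler_norm (l + 1 - b); rewrite /W /E0; lra.
have xdE t : T <= t -> `|xd t| <= E0.
  move=> Tt; rewrite -(ler_pXn2r (n := 2)) ?nnegrE//; last by lra.
  rewrite -(inner_norm Hin) -/(e t); apply: (le_trans (eE t Tt)).
  by rewrite expr2 ler_peMl//; lra.
have [c cL] := g_lipschitz i0.
pose G := `|g i0 0| + `|c| * M.
have gG t : t0 <= t -> `|g i0 (x t)| <= G.
  move=> t0t; have -> : g i0 (x t) = g i0 0 + (g i0 (x t) - g i0 0) by rewrite subrKC.
  apply: (le_trans (ler_normD _ _)); rewrite lerD2l; apply: (le_trans (cL _ _)).
  rewrite subr0; apply: (@le_trans _ _ (`|c| * `|x t|)).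
    by rewrite ler_wpM2r// ler_norm.
  by rewrite ler_wpM2l// x_bounded.
have G0 : 0 <= G by rewrite addr_ge0// mulr_ge0.
pose Bc := 2 * (G * E0 + beta / t0 `^ p * (M * E0)) + 1.
have bt : 0 <= beta / t0 `^ p by rewrite divr_ge0 ?powR_ge0// ltW.
have Bc0 : 0 < Bc.
  have : 0 <= G * E0 + beta / t0 `^ p * (M * E0).
    by rewrite addr_ge0// mulr_ge0// ?mulr_ge0//; lra.
  by rewrite /Bc; lra.
have mono : forall s t, T <= s -> s <= t -> e t + - Bc * t <= e s + - Bc * s.
  apply: (@dominated_nincr _ _ xd t0 T (fun t => e t + - Bc * t)) => //.
    move=> T' t0T'; apply: dominated_add; first exact: dom_e.
    apply: dominated_scale => //; apply: (@dominated_lipschitz _ _ _ _ _ _ 1) => //.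
    by move=> u w _ uw _; rewrite mul1r ger0_norm// subr_ge0.
  apply: filterS dynamics; first exact: ae_filter.
  move=> t H Tt; have t0t := le_trans t0T Tt; have [D [d dg [dE di]]] := H t0t.
  exists (⟨xdd t, xd t⟩ + ⟨xd t, xdd t⟩ + - Bc * 1).
    by apply: is_derive_add; exact: is_derive_inner.
  rewrite (innerC Hin (xd t)); have := energy_slope t0t dE (di i0).
  have : 0 <= alpha / t `^ q * e t by rewrite mulr_ge0 ?e_ge0// divr_ge0 ?powR_ge0// ltW.
  have H1 : - ⟨g i0 (x t), xd t⟩ <= G * E0.
    have := norm_inner Hin (g i0 (x t)) (xd t); rewrite ler_norml => /andP[+ _].
    have := ler_pM (normr_ge0 _) (normr_ge0 _) (gG t t0t) (xdE t Tt); lra.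
  have H2 : - (beta / t `^ p * ⟨x t, xd t⟩) <= beta / t0 `^ p * (M * E0).
    rewrite -mulrN; apply: (@le_trans _ _ (beta / t `^ p * (M * E0))).
      rewrite ler_wpM2l//; first by rewrite divr_ge0 ?powR_ge0// ltW.
      have := norm_inner Hin (x t) (xd t); rewrite ler_norml => /andP[+ _].
      have := ler_pM (normr_ge0 _) (normr_ge0 _) (x_bounded t0t) (xdE t Tt); lra.
    rewrite ler_wpM2r//; first by rewrite mulr_ge0//; lra.
    rewrite ler_pM2l// -!powRN; apply: powR_nincr => //; move: q0 qp; lra.
  by rewrite /Bc; lra.
have tq0 : 0 < t0 `^ q by exact: powR_gt0.
(* L' = t^q e >= t0^q e supplies the constant c. *)
apply: (@barbalat R T (t0 `^ q) Bc B L (fun t => t `^ q * e t) e tq0 Bc0).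
- by move=> t Tt; apply: LP; exact: le_trans Tt.
- move=> t Tt; rewrite ler_wpM2r ?e_ge0//; have t0t := le_trans t0T Tt.
  by apply: ge0_ler_powR; rewrite ?nnegrE//; apply: ltW => //; exact: pos.
- by move=> t _; exact: e_ge0.
- by move=> t Tt; apply: LB; exact: le_trans Tt.
- by move=> s t Ts st; have := mono s t Ts st; lra.
Qed.

Lemma values_cvg (l : R) i : W i t @[t --> +oo] --> l -> e t @[t --> +oo] --> (0 : R) ->
  f i (x t) @[t --> +oo] --> l.
Proof.
move=> Wl el.
have xx0 : t `^ (- p) * ⟨x t, x t⟩ @[t --> +oo] --> (0 : R).
  have pp : - p < 0 by move: q0 qp; lra.
  have n0 : 0 < M ^+ 2 + 1 by rewrite ltr_wpDl// exprn_ge0.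
  apply/cvgr_pinftyP => d d0.
  have [T TP] := (cvgr_pinftyP _ _).1 (powRN_cvg0 pp) (d / (M ^+ 2 + 1)) (divr_gt0 d0 n0).
  exists (Order.max T t0) => t; rewrite ge_max => /andP[/TP + t0t].
  rewrite !subr0 ler_pdivlMr// normrM => H; apply: le_trans H.
  rewrite ler_wpM2l// (inner_norm Hin) ger0_norm ?exprn_ge0//.
  by apply: (@le_trans _ _ (M ^+ 2)); [rewrite ler_pXn2r ?nnegrE ?x_bounded|rewrite lerDl].
have -> : (fun t => f i (x t)) =
    (fun t => W i t - (beta / 2 * (t `^ (- p) * ⟨x t, x t⟩) + 2^-1 * e t)).
  by apply/funext => t; rewrite /W addrK.
have -> : l = l - (beta / 2 * 0 + 2^-1 * 0) by rewrite !mulr0 addr0 subr0.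
by apply: cvgB => //; apply: cvgD; exact: cvgMr.
Qed.

(* If z strictly improved on all the limit values, the second derivative of |x - z|^2 / 2 would be
   eventually bounded above by a negative constant, although its first derivative is bounded. *)
Lemma no_strict_improvement (finf : 'I_m -> R) (z : V) :
  e t @[t --> +oo] --> (0 : R) -> (forall i, f i (x t) @[t --> +oo] --> finf i) ->
  (forall i, f i z < finf i) -> False.
Proof.
move=> el fl zf.
have [d d0 dz] : exists2 d : R, 0 < d & forall i, f i z + d <= finf i.
  case: (@arg_minP _ R 'I_m i0 xpredT (fun i => finf i - f i z)) => // i _ imin.
  exists (finf i - f i z); first by rewrite subr_gt0.
  by move=> j; have := imin j isT; lra.
have ff : \forall t \near +oo, forall i, d / 2 <= f i (x t) - f i z.
  apply: filter_forall => i; have d20 : 0 < d / 2 by rewrite divr_gt0.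
  have [T TP] := (cvgr_pinftyP _ _).1 (fl i) _ d20.
  apply: filterS (near_ge T) => t /TP; rewrite ler_norml => /andP[+ _].
  by have := dz i; lra.
have pp : - p < 0 by move: q0 qp; lra.
(* Budget: from the gap - d / 2, the velocity, Tikhonov and damping terms take at most d / 16 each,
   leaving a slope below - d / 4. The speed threshold r is chosen so that the damping term is at
   most A r = d / 16. *)
pose A := alpha / t0 `^ q * (M + `|z|) + 1.
have aq : 0 <= alpha / t0 `^ q by rewrite divr_ge0 ?powR_ge0// ltW.
have A1 : 1 <= A by rewrite lerDr mulr_ge0// addr_ge0.
have A0 : 0 < A by lra.
pose r := d / 16 / A.
have r0 : 0 < r by rewrite !divr_gt0.
have e_small : \forall t \near +oo, e t <= Order.min (d / 16) (r ^+ 2).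
  have m0 : 0 < Order.min (d / 16) (r ^+ 2) by rewrite lt_min divr_gt0// exprn_gt0.
  have [T TP] := (cvgr_pinftyP _ _).1 el _ m0.
  apply: filterS (near_ge T) => t /TP; rewrite subr0; exact: le_trans (ler_norm _).
have p_small : \forall t \near +oo, beta / 2 / t `^ p * `|z| ^+ 2 <= d / 16.
  have n0 : 0 < beta / 2 * `|z| ^+ 2 + 1.
    by rewrite ltr_wpDl// mulr_ge0 ?exprn_ge0// divr_ge0 ?ltW.
  have [T TP] := (cvgr_pinftyP _ _).1 (powRN_cvg0 pp) _ (divr_gt0 (divr_gt0 d0 (ltr0Sn _ 15)) n0).
  apply: filterS (near_ge T) => t /TP; rewrite subr0 ger0_norm ?powR_ge0// powRN ler_pdivlMr//.
  have : 0 <= (t `^ p)^-1 by rewrite invr_ge0 powR_ge0.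
  lra.
have [T [t0T TP]] : exists T, t0 <= T /\ forall t, T <= t ->
    [/\ forall i, d / 2 <= f i (x t) - f i z, e t <= Order.min (d / 16) (r ^+ 2) &
        beta / 2 / t `^ p * `|z| ^+ 2 <= d / 16].
  have [S [_ SP]] := filterI ff (filterI e_small p_small).
  exists (Order.max (S + 1) t0); split; first by rewrite le_max lexx orbT.
  move=> t; rewrite ge_max => /andP[St _]; have /SP[] : S < t by lra.
  by move=> ? [].
have xdr t : T <= t -> `|xd t| <= r.
  move=> Tt; have [_ + _] := TP t Tt; rewrite le_min => /andP[_].
  by rewrite /e (inner_norm Hin) ler_pXn2r ?nnegrE ?(ltW r0).
have hdb t : T <= t -> `|⟨x t - z, xd t⟩| <= (M + `|z|) * r.
  move=> Tt; apply: (le_trans (norm_inner Hin _ _)); apply: ler_pM => //; last exact: xdr.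
  apply: (le_trans (ler_normB _ _)); rewrite lerD2r x_bounded//; exact: le_trans Tt.
have mono : forall s t, T <= s -> s <= t ->
    ⟨x t - z, xd t⟩ + d / 4 * t <= ⟨x s - z, xd s⟩ + d / 4 * s.
  apply: (@dominated_nincr _ _ xd t0 T (fun t => ⟨x t - z, xd t⟩ + d / 4 * t)) => //.
    move=> T' t0T'; apply: dominated_add; first exact: dominated_anchor_derive.
    apply: dominated_scale => //; apply: (@dominated_lipschitz _ _ _ _ _ _ 1) => //.
    by move=> u w _ uw _; rewrite mul1r ger0_norm// subr_ge0.
  apply: filterS dynamics; first exact: ae_filter.
  move=> t H Tt; have t0t := le_trans t0T Tt; have [D [c cg [cE ci]]] := H t0t.
  exists (e t + ⟨x t - z, xdd t⟩ + d / 4 * 1).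
    by apply: is_derive_add; exact: anchor_derive2.
  have [f1 e1 p1] := TP t Tt.
  have := anchor_slope t0t cg cE f1.
  move: e1; rewrite le_min => /andP[e1 _].
  have bt : 0 <= beta / 2 / t `^ p * ⟨x t, x t⟩.
    by rewrite mulr_ge0 ?(inner_norm Hin) ?exprn_ge0// divr_ge0 ?powR_ge0// divr_ge0 ?ltW.
  have : - (alpha / t `^ q * ⟨x t - z, xd t⟩) <= d / 16.
    rewrite -mulrN; apply: (@le_trans _ _ (alpha / t0 `^ q * ((M + `|z|) * r))).
      apply: (@le_trans _ _ (alpha / t `^ q * ((M + `|z|) * r))).
        rewrite ler_wpM2l//; first by rewrite divr_ge0 ?powR_ge0// ltW.
        by have := hdb t Tt; rewrite ler_norml => /andP[+ _]; lra.
      rewrite ler_wpM2r//; first by rewrite mulr_ge0 ?addr_ge0// ltW.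
      rewrite ler_pM2l// -!powRN; apply: powR_nincr => //; move: q0; lra.
    rewrite mulrA; apply: (@le_trans _ _ (A * r)); first by rewrite ler_pM2r// lerDl.
    by rewrite /r mulrC divfK// gt_eqF.
  by lra.
(* By this time the descent at slope d / 4 exceeds by 1 the largest variation allowed by [hdb]. *)
pose t := T + (2 * ((M + `|z|) * r) + 1) / (d / 4).
have d40 : 0 < d / 4 by rewrite divr_gt0.
have Mr : 0 <= (M + `|z|) * r by rewrite mulr_ge0 ?addr_ge0// ltW.
have Tt : T <= t by rewrite lerDl divr_ge0 ?(ltW d40)//; lra.
have := mono T t (lexx T) Tt.
have := hdb t Tt; rewrite ler_norml => /andP[+ _].
have := hdb T (lexx T); rewrite ler_norml => /andP[_].
have -> : d / 4 * t = d / 4 * T + (2 * ((M + `|z|) * r) + 1).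
  by rewrite /t mulrDr mulrC (mulrC (d / 4) (_ / _)) divfK ?gt_eqF// mulrC.
lra.
Qed.

Lemma trajectory_weak_cvg : exists finf : 'I_m -> R,
  (forall i, f i (x t) @[t --> +oo] --> finf i) /\
  exists2 xs, weak_pareto f xs /\ (forall i, f i xs <= finf i) &
    forall y, ⟨x t, y⟩ @[t --> +oo] --> ⟨xs, y⟩.
Proof.
have [finf [k [Wf k0 dk kW]]] := energy_limits.
have [xs xsf xs_lim] := weak_cvg_sublevel Wf k0 dk kW.
(* The weak limit itself serves as the anchor that makes t^q |x'|^2 integrable. *)
have [_ [L [B [LP LB]]]] := anchored_Lyapunov k0 dk kW xsf.
have el := velocity_cvg0 (Wf i0) LP LB.
have fl i := values_cvg (Wf i) el.
exists finf; split => //; exists xs => //; split=> // -[z zlt].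
apply: (no_strict_improvement el fl (z := z)) => i; exact: lt_le_trans (zlt i) (xsf i).
Qed.

End Trajectory.

Theorem mainTheorem18 (R : realType) (V : completeNormedModType R)
  (inner : V -> V -> R) (m : nat) (f : 'I_m -> V -> R) (g : 'I_m -> V -> V)
  (t0 alpha beta q p : R) (x0 v0 : V)
  (x xd xdd : R -> V) :
  is_inner inner ->
  (forall i, convex_fun (f i)) ->
  (forall i, is_gradient inner (f i) (g i)) ->
  (forall i, lipschitz_map (g i)) ->
  0 < t0 -> 0 < alpha -> 0 < beta -> 0 < q <= 1 -> 0 < p <= 2 ->
  (* (A3) *)
  (let a := beta / (2 * t0 `^ p) * `|x0| ^+ 2 + 2^-1 * `|v0| ^+ 2 in
   (forall z, levelset f (fun i => f i x0 + a) z ->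
      exists y, LPw f (fun i => f i z) y) /\
   (exists Rb : R, forall z0, LPw f (fun i => f i x0 + a) z0 ->
      inf [set `|z| | z in [set z | forall i, f i z = f i z0]] <= Rb)) ->
  (* (A4) *)
  (forall w, argmin_max f w !=set0) ->
  (exists s : ('I_m -> R) -> V,
     (forall w, is_proj (argmin_max f w) 0 (s w)) /\
     (forall w (e : R), 0 < e -> exists2 d : R, 0 < d &
        forall w', (forall i, `|w' i - w i| < d) -> `|s w' - s w| < e)) ->
  (* parameter regime *)
  ((p < 2 /\ q + 1 < p) \/ (p = 2 /\ q < 1 /\ q * (1 - q) <= beta)) ->
  (* x is a trajectory solution of (MTRIGS) *)
  (forall t : R, is_derive (t : R^o) (1 : R^o) x (xd t)) ->
  continuous xd ->
  (forall T, t0 <= T -> abs_cont_on xd t0 T) ->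
  {ae (@lebesgue_measure R), forall t : R, t0 <= t -> is_derive (t : R^o) (1 : R^o) xd (xdd t)} ->
  {ae (@lebesgue_measure R), forall t, t0 <= t ->
     is_proj [set y | exists2 c, convhull g (x t) c &
                        y = c + (beta / t `^ p) *: x t + xdd t]
             0 (- ((alpha / t `^ q) *: xd t))} ->
  x t0 = x0 -> xd t0 = v0 ->
  (* x bounded *)
  (exists M : R, forall t, t0 <= t -> `|x t| <= M) ->
  exists finf : 'I_m -> R,
    (forall i, f i (x t) @[t --> +oo] --> finf i) /\
    exists2 xs : V, weak_pareto f xs /\ (forall i, f i xs <= finf i) &
      forall y : V, inner (x t) y @[t --> +oo] --> inner xs y.
Proof.
move=> Hin f_convex f_gradient g_lipschitz t00 al0 be0 /andP[q0 _] _ _ A4 _ pq.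
move=> x_derive xd_cont xd_ac xd_derive x_proj _ _ [M x_bounded].
(* Both regimes meet here: q + 1 < p < 2 in the first, q + 1 < 2 = p in the second. *)
have [q1 qp] : q < 1 /\ q + 1 < p by case: pq => [[]|[-> []]]; lra.
(* Testing a minimizer against itself yields an index, so m > 0. *)
have [z /(_ z)[i0 _]] := A4 (fun=> 0).
exact: (@trajectory_weak_cvg R V inner m f g t0 alpha beta q p M x xd xdd).
Qed.
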